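(* Let $\mathbb{D}=\{z\in\mathbb{C}:|z|<1\}$ be the unit disk, let $\alpha_1,\ldots,\alpha_N$ be $N$ distinct points of $\mathbb{D}$, and to each $\alpha_i$ associate $n_i\ge 1$ complex numbers $c_{i0},c_{i1},\ldots,c_{i,n_i-1}$. Let $\Gamma$ and $C$ be the square complex matrices of size $n_1+\cdots+n_N$ associated with these data as defined in the context, and let $$A=\Gamma-C\,\Gamma\,C^{\ast},$$ where $C^{\ast}$ is the conjugate transpose of $C$; $A$ is a Hermitian matrix of size $n_1+\cdots+n_N$. Then a necessary and sufficient condition for the existence of a holomorphic function $\phi\colon\mathbb{D}\to\mathbb{D}$ such that $$\phi(z)=\sum_{j=0}^{n_i-1}c_{ij}(z-\alpha_i)^j+O\big((z-\alpha_i)^{n_i}\big)\qquad (i=1,\ldots,N)$$ is that the matrix $A$ is positive semidefinite.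
   Context: For $1\le i,j\le N$, let $a^{(i,j)}_{kl}$ ($k,l\ge 0$) be the coefficients of the expansion (for $z$ near $\alpha_i$ and $\zeta$ near $\alpha_j$) $$\frac{1}{1-z\overline{\zeta}}=\sum_{k,l\ge 0}a^{(i,j)}_{kl}\,(z-\alpha_i)^k\,\big(\overline{\zeta-\alpha_j}\big)^l .$$ Let $\Gamma_{ij}$ be the $n_i\times n_j$ matrix $$\Gamma_{ij}=\big(a^{(i,j)}_{kl}\big)_{0\le k\le n_i-1,\ 0\le l\le n_j-1},$$ and let $\Gamma=(\Gamma_{ij})_{1\le i,j\le N}$ be the block matrix with blocks $\Gamma_{ij}$. For each $i$, let $C_i$ be the $n_i\times n_i$ lower triangular Toeplitz matrix whose $(k,l)$ entry, for $0\le k,l\le n_i-1$, is $c_{i,k-l}$ if $k\ge l$ and $0$ if $k<l$. Let $C=\operatorname{diag}(C_1,\ldots,C_N)$ be the block diagonal matrix with diagonal blocks $C_1,\ldots,C_N$.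
   Formalization: As stated it fails if the data are jets of a constant u with |u|=1 (e.g. N=1, n_1=1, c_{10}=1: A=0, but no φ into the open disk). Proved instead: the equivalence for φ from D into the closed disk for all data, and for φ: D→D whenever the data are not such jets. *)

(* Defs.v *)
From HB Require Import structures.
From mathcomp Require Import all_boot all_order all_algebra finmap.
From mathcomp Require Import all_classical all_reals all_analysis.
From mathcomp.analysis.showcase Require Import summability.
From mathcomp Require Import complex.

Set Implicit Arguments.
Unset Strict Implicit.
Unset Printing Implicit Defensive.

Import Order.TTheory GRing.Theory Num.Theory.
Import numFieldNormedType.Exports.

Local Open Scope classical_set_scope.
Local Open Scope ring_scope.
Local Open Scope sesquilinear_scope.

Section NevanlinnaPick.
Context {R : realType}.
Local Notation C := (R[i]).

(* Derivability in the direction 1 of a map C^o -> C^o, where C^o is a normed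
   space over the field C itself, is complex differentiability. Only the values
   of phi on the open unit disk matter. *)
Definition holomorphic_on_disk (phi : C -> C) : Prop :=
  forall z : C, `|z| < 1 -> derivable (phi : C^o -> C^o) z 1.

(* Only the coefficients c i j with j < n i are used, here and below. *)
Definition interpolates N (alpha : 'I_N -> C) (n : 'I_N -> nat)
    (c : 'I_N -> nat -> C) (phi : C -> C) : Prop :=
  forall i : 'I_N,
    (phi : C^o -> C^o) =
      (fun z : C^o => \sum_(j < n i) c i j * (z - alpha i) ^+ j : C^o)
      +O_ (nbhs (alpha i : C^o)) (fun z : C^o => (z - alpha i) ^+ n i : C^o).

(* The double series is summed unconditionally: the sums over the finite sets
   of pairs (k, l) converge along the inclusion order of these sets. *)
Definition kernel_expansion (alpha beta : C) (a : nat -> nat -> C) : Prop :=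
  \forall z \near (alpha : C^o) & w \near (beta : C^o),
    (partial_sum (fun kl : nat * nat =>
       (a kl.1 kl.2 * (z - alpha) ^+ kl.1 * (w - beta)^* ^+ kl.2 : C^o))
     @ totally --> ((1 - z * w^*)^-1 : C^o)).

Definition Gamma_mx N (n : 'I_N -> nat) (a : 'I_N -> 'I_N -> nat -> nat -> C) :
    'M[C]_(\sum_(i < N) n i) :=
  \mxblock_(i < N, j < N) \matrix_(k < n i, l < n j) a i j k l.

Definition toeplitz_mx m (c : nat -> C) : 'M[C]_m :=
  \matrix_(k < m, l < m) if (l <= k)%N then c (k - l)%N else 0.

Definition C_mx N (n : 'I_N -> nat) (c : 'I_N -> nat -> C) :
    'M[C]_(\sum_(i < N) n i) :=
  \mxdiag_(i < N) toeplitz_mx (n i) (c i).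

Definition pick_mx N (n : 'I_N -> nat) (a : 'I_N -> 'I_N -> nat -> nat -> C)
    (c : 'I_N -> nat -> C) : 'M[C]_(\sum_(i < N) n i) :=
  Gamma_mx n a - C_mx n c *m Gamma_mx n a *m (C_mx n c) ^t*.

(* In the partial order of C, 0 <= x says that x is real and nonnegative. *)
Definition psdmx m (A : 'M[C]_m) : Prop :=
  A \is hermsymmx /\ forall v : 'cV[C]_m, 0 <= (v ^t* *m A *m v) 0 0.

(* The prescribed jets are those of a constant u of modulus 1. Then, for
   0 < N, pick_mx n a c = 0 and u is the only interpolant with values in the
   closed disk (up to its values off the disk), so that
   there is none with values in the open disk. *)
Definition unimodular_constant_data N (n : 'I_N -> nat) (c : 'I_N -> nat -> C) :
    Prop :=
  exists2 u : C, `|u| = 1 &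
    forall (i : 'I_N) (j : nat), (j < n i)%N -> c i j = if j == 0%N then u else 0.

End NevanlinnaPick.

(* Main.v *)
Require Import Defs.
From mathcomp Require Import all_boot all_order all_algebra finmap.
From mathcomp Require Import all_classical all_reals all_analysis.
From mathcomp.analysis.showcase Require Import summability.
From mathcomp Require Import complex ring lra.
Import Order.TTheory GRing.Theory Num.Theory.
Import numFieldNormedType.Exports Normc.
Set Implicit Arguments.
Unset Strict Implicit.
Unset Printing Implicit Defensive.
Local Open Scope ring_scope.

(** Everything is read on one matrix.  Let Z be block diagonal, with the lower
Jordan block of size n i and eigenvalue alpha i as its i-th block; let e collect
the jets at the nodes of the constant function 1, and c the prescribed jets.
Multiplying the expansion of 1 / (1 - z conj(w)) by 1 - z conj(w) and comparing
coefficients gives Gamma - Z Gamma adj(Z) = e adj(e).  The matrix C commutes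
with Z and sends e to c, so A solves the Stein equation
  A - Z A adj(Z) = e adj(e) - c adj(c)                        [stein_pick],
whose solution is unique because the eigenvalues of Z lie in the disk.  On the
other side, a holomorphic phi bounded by 1 interpolates the data if and only if
  h(z) = (z - Z)^-1 (phi(z) e - c)
stays bounded on the disk [interpolates_resolves, resolves_interpolates]: the
entries of h are the quotients of the Taylor remainders of phi by powers of
z - alpha i.

In this form e, c and the lower triangular matrix Z can be arbitrary, and the
Schur algorithm removes one coordinate at a time.  Let a be the first diagonal
entry of Z; suppose that e_0 is not zero and that g = c_0 / e_0, the value that
phi must take at a, satisfies |g| < 1.  Then
  psi(z) = (phi(z) - g) / (1 - conj(g) phi(z)) * (1 - conj(a) z) / (z - a)
solves a problem of the same kind on the other coordinates
[schur_resolves, schur_unresolves], and for some vector y with y_0 nonzero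
  A = (1 - |a|^2) y adj(y) + (0 (+) A'),
where A' is the solution of the Stein equation of the reduced problem
[schur_step].  So A is positive semidefinite exactly when A' is, and induction
gives both directions.

Sufficiency [resolves_of_nonneg] is then pure algebra.  The entry A_00 is
(|e_0|^2 - |c_0|^2) / (1 - |a|^2), so |c_0| <= |e_0|; in the case of equality
the first column of A vanishes, and either c = u e for a unimodular u, which is
solved by the constant u, or e_0 = c_0 = 0 and the first coordinate can be
dropped.  Otherwise the solution is (psi b + g) / (1 + conj(g) psi b) with b
the Blaschke factor at a; since |b| < 1 on the disk it takes its values in the
open disk.  Thus a unimodular constant is the only exception to strictness.

Necessity [nonneg_of_resolves] is first proved for r phi and r c with r < 1,
where |g| <= r, and then r tends to 1.  The analytic input is that psi is again
bounded by 1.  The functions of the induction are only known to be bounded and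
differentiable off a finite set s, so that the maximum principle is applied to
psi^m Q^2, where Q is the product of the z - p for p in s: this function is
differentiable everywhere, and m-th roots with m tending to infinity remove the
factor Q [schwarz_exceptional].  Differentiability at each point being the only
hypothesis, the maximum principle rests on the bisection argument of Goursat
[goursat], applied to the real and imaginary parts in the coordinates
z = p + exp(x + i y). *)

(** * Goursat's theorem on rectangles, for a pair of real functions *)

Section Goursat.
Local Open Scope classical_set_scope.

Context {R : realType}.
Implicit Types (f : R -> R) (P Q : R -> R -> R).

Definition segint f (a b : R) : R := \int[lebesgue_measure]_(t in `[a, b]) f t.

Definition continuous_on (f : R -> R) (a b : R) :=
  forall t, a <= t <= b -> {for t, continuous f}.

Lemma continuous_on_integrable f a b : continuous_on f a b ->
  lebesgue_measure.-integrable `[a, b] (EFin \o f).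
Proof.
move=> cf; apply: continuous_compact_integrable; first exact: segment_compact.
apply: continuous_in_subspaceT => t; rewrite inE/= in_itv/= => tab.
exact: cf.
Qed.

Lemma continuous_onB f g a b : continuous_on f a b -> continuous_on g a b ->
  continuous_on (fun t => f t - g t) a b.
Proof.
move=> cf cg t tab; apply: (@continuousB _ _ _ f g); [exact: cf|exact: cg].
Qed.

Lemma segintB f g a b : continuous_on f a b -> continuous_on g a b ->
  segint (fun t => f t - g t) a b = segint f a b - segint g a b.
Proof.
by move=> cf cg; apply: RintegralB => //; exact: continuous_on_integrable.
Qed.

Lemma segint_cst (k a b : R) : a <= b -> segint (fun=> k) a b = k * (b - a).
Proof.
move=> ab; rewrite /segint Rintegral_cst// [X in fine X]lebesgue_measure_itv/= lte_fin.
by case: ltgtP ab => // -> _; rewrite subrr.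
Qed.

Lemma segint_le f a b k : a <= b -> continuous_on f a b ->
  (forall t, a <= t <= b -> f t <= k) -> segint f a b <= k * (b - a).
Proof.
move=> ab cf fk; rewrite -segint_cst//; apply: le_Rintegral => //.
- exact: continuous_on_integrable cf.
- by apply: continuous_on_integrable => t _; exact: cst_continuous.
Qed.

Lemma segint_ge f a b k : a <= b -> continuous_on f a b ->
  (forall t, a <= t <= b -> k <= f t) -> k * (b - a) <= segint f a b.
Proof.
move=> ab cf fk; rewrite -segint_cst//; apply: le_Rintegral => //.
- by apply: continuous_on_integrable => t _; exact: cst_continuous.
- exact: continuous_on_integrable cf.
Qed.

Lemma segint_cat f a m b : a <= m <= b -> continuous_on f a b ->
  segint f a b = segint f a m + segint f m b.
Proof.
move=> /andP[am mb] cf; have fi := continuous_on_integrable cf.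
have fi2 := @Rintegral_itvB R f (BLeft a) (BRight b) m fi.
rewrite !bnd_simp in fi2.
rewrite /segint -(@Rintegral_itv_obnd_cbnd _ m); last first.
  by apply: integrableS fi => //; apply: subset_itvr; rewrite bnd_simp.
by rewrite -(fi2 am mb); ring.
Qed.

Definition has_grad (P : R -> R -> R) (x y a b : R) := forall e : R, 0 < e ->
  exists2 d : R, 0 < d & forall x' y', `|x' - x| < d -> `|y' - y| < d ->
    `|P x' y' - (P x y + a * (x' - x) + b * (y' - y))| <=
      e * (`|x' - x| + `|y' - y|).

(** The integral of P dx + Q dy along the boundary of the rectangle with lower
left corner (x, y), width w and height h. *)
Definition boundary_int P Q x w y h : R :=
  (segint (P^~ y) x (x + w) - segint (P^~ (y + h)) x (x + w)) +
  (segint (Q (x + w)) y (y + h) - segint (Q x) y (y + h)).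

Lemma lipschitz_at_continuous (f : R -> R) x d k : 0 < d ->
  (forall t, `|t - x| < d -> `|f t - f x| <= k * `|t - x|) ->
  {for x, continuous f}.
Proof.
move=> d0 H; apply/cvgrPdist_le => /= e e0.
have k0 : 0 < `|k| + 1 by rewrite ltr_wpDl.
near=> t; have td : `|t - x| < d.
  by near: t; exists d => //= t; rewrite distrC.
have te : `|t - x| <= e / (`|k| + 1).
  by near: t; exists (e / (`|k| + 1)) => /=; [rewrite divr_gt0|move=> t; rewrite distrC; exact: ltW].
rewrite distrC (le_trans (H _ td))//.
rewrite (@le_trans _ _ ((`|k| + 1) * `|t - x|))//.
  by rewrite ler_wpM2r// (le_trans (ler_norm k))// lerDl.
by rewrite mulrC -ler_pdivlMr.
Unshelve. all: by end_near. Qed.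

Lemma has_grad_continuous P x y a b : has_grad P x y a b ->
  {for x, continuous (P^~ y)} /\ {for y, continuous (P x)}.
Proof.
move=> /(_ 1 ltr01)[d d0 dP]; split.
  apply: (@lipschitz_at_continuous _ x d (`|a| + 1)) => // t td.
  have := dP t y td; rewrite subrr normr0 => /(_ d0).
  rewrite mulr0 !addr0 mul1r => Pt.
  have -> : P t y - P x y = (P t y - (P x y + a * (t - x))) + a * (t - x) by ring.
  by rewrite (le_trans (ler_normD _ _))// mulrDl mul1r addrC lerD// normrM.
apply: (@lipschitz_at_continuous _ y d (`|b| + 1)) => // t td.
have := dP x t; rewrite subrr normr0 => /(_ d0 td).
rewrite mulr0 !addr0 add0r mul1r => Pt.
have -> : P x t - P x y = (P x t - (P x y + b * (t - y))) + b * (t - y) by ring.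
by rewrite (le_trans (ler_normD _ _))// mulrDl mul1r addrC lerD// normrM.
Qed.

Lemma nested_intervals (l r : nat -> R) :
  (forall k, l k <= l k.+1) -> (forall k, r k.+1 <= r k) ->
  (forall k, l k <= r k) -> exists x, forall k, l k <= x <= r k.
Proof.
move=> hl hr lr.
have ml : {homo l : m n / (m <= n)%N >-> m <= n} by apply/nondecreasing_seqP.
have mr : {homo r : m n / (m <= n)%N >-> n <= m} by apply/nonincreasing_seqP.
have lrjk j k : l j <= r k.
  rewrite (le_trans (ml _ _ (leq_maxl j k)))//.
  by rewrite (le_trans (lr _))// mr// leq_maxr.
exists (sup (range l)) => k; apply/andP; split.
  apply: ub_le_sup; last by exists k.
  by exists (r 0%N) => _ [j _ <-].
apply: ge_sup; first by exists (l 0%N); exists 0%N.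
by move=> _ [j _ <-].
Qed.

Lemma boundary_int_split P Q x w y h : 0 <= w -> 0 <= h ->
  (forall s t, x <= s <= x + w -> y <= t <= y + h ->
    [/\ {for s, continuous (P^~ t)}, {for t, continuous (P s)},
        {for s, continuous (Q^~ t)} & {for t, continuous (Q s)}]) ->
  boundary_int P Q x w y h = boundary_int P Q x (w / 2) y (h / 2) +
    boundary_int P Q (x + w / 2) (w / 2) y (h / 2) +
    boundary_int P Q x (w / 2) (y + h / 2) (h / 2) +
    boundary_int P Q (x + w / 2) (w / 2) (y + h / 2) (h / 2).
Proof.
move=> w0 h0 c; rewrite /boundary_int -!addrA.
have -> : w / 2 + w / 2 = w by field.
have -> : h / 2 + h / 2 = h by field.
have cP t : y <= t <= y + h -> continuous_on (P^~ t) x (x + w).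
  by move=> yt s xs; have [] := c s t xs yt.
have cQ s : x <= s <= x + w -> continuous_on (Q s) y (y + h).
  by move=> xs t yt; have [] := c s t xs yt.
have xm : x <= x + w / 2 <= x + w by lra.
have ym : y <= y + h / 2 <= y + h by lra.
rewrite (segint_cat xm (cP y _)) ?(segint_cat xm (cP (y + h) _)); [|lra|lra].
rewrite (segint_cat ym (cQ x _)) ?(segint_cat ym (cQ (x + w) _)); [|lra|lra].
by ring.
Qed.

(** The coefficient of t in the approximation of P is that of s in the
approximation of Q: the affine form so obtained is closed and its boundary
integral is zero.  Only the error terms remain. *)
Lemma boundary_int_bound P Q x w y h p0 q0 a b d x0 y0 E : 0 <= w -> 0 <= h ->
  (forall s t, x <= s <= x + w -> y <= t <= y + h ->
    [/\ {for s, continuous (P^~ t)}, {for t, continuous (P s)},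
        {for s, continuous (Q^~ t)} & {for t, continuous (Q s)}]) ->
  (forall s t, x <= s <= x + w -> y <= t <= y + h ->
    `|P s t - (p0 + a * (s - x0) + b * (t - y0))| <= E /\
    `|Q s t - (q0 + b * (s - x0) + d * (t - y0))| <= E) ->
  `|boundary_int P Q x w y h| <= 2 * E * (w + h).
Proof.
move=> w0 h0 c H; rewrite /boundary_int.
have cP t : y <= t <= y + h -> continuous_on (P^~ t) x (x + w).
  by move=> yt s xs; have [] := c s t xs yt.
have cQ s : x <= s <= x + w -> continuous_on (Q s) y (y + h).
  by move=> xs t yt; have [] := c s t xs yt.
have y0h : y <= y <= y + h by lra.
have y1h : y <= y + h <= y + h by lra.
have x0h : x <= x <= x + w by lra.
have x1h : x <= x + w <= x + w by lra.
rewrite -!segintB; [|exact: cQ|exact: cQ|exact: cP|exact: cP].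
have cPP := continuous_onB (cP _ y0h) (cP _ y1h).
have cQQ := continuous_onB (cQ _ x1h) (cQ _ x0h).
have xx : x <= x + w by lra.
have yy : y <= y + h by lra.
have P1 : segint (fun t => P t y - P t (y + h)) x (x + w) <= (- b * h + 2 * E) * (x + w - x).
  apply: segint_le => // t tx; have [+ _] := H t y tx y0h; have [+ _] := H t _ tx y1h.
  by rewrite !ler_norml; lra.
have P2 : (- b * h - 2 * E) * (x + w - x) <= segint (fun t => P t y - P t (y + h)) x (x + w).
  apply: segint_ge => // t tx; have [+ _] := H t y tx y0h; have [+ _] := H t _ tx y1h.
  by rewrite !ler_norml; lra.
have Q1 : segint (fun t => Q (x + w) t - Q x t) y (y + h) <= (b * w + 2 * E) * (y + h - y).
  apply: segint_le => // t ty; have [_ +] := H x t x0h ty; have [_ +] := H _ t x1h ty.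
  by rewrite !ler_norml; lra.
have Q2 : (b * w - 2 * E) * (y + h - y) <= segint (fun t => Q (x + w) t - Q x t) y (y + h).
  apply: segint_ge => // t ty; have [_ +] := H x t x0h ty; have [_ +] := H _ t x1h ty.
  by rewrite !ler_norml; lra.
by rewrite ler_norml; nra.
Qed.

(** A quarter of the rectangle, given by its lower left corner, that carries at
least a quarter of the boundary integral. *)
Definition quarter P Q (w h : R) (p : R * R) : R * R :=
  let I p := `|boundary_int P Q p.1 (w / 2) p.2 (h / 2)| in
  let J := `|boundary_int P Q p.1 w p.2 h| / 4 in
  let q1 := p in let q2 := (p.1 + w / 2, p.2) in
  let q3 := (p.1, p.2 + h / 2) in let q4 := (p.1 + w / 2, p.2 + h / 2) in
  if J <= I q1 then q1 else if J <= I q2 then q2 else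
  if J <= I q3 then q3 else q4.

Lemma quarter_in P Q w h p : 0 <= w -> 0 <= h ->
  (p.1 <= (quarter P Q w h p).1 <= p.1 + w / 2) /\
  (p.2 <= (quarter P Q w h p).2 <= p.2 + h / 2).
Proof. by move=> w0 h0; rewrite /quarter; do 3?case: ifP => _ /=; lra. Qed.

Lemma le_boundary_int_quarter P Q w h p : 0 <= w -> 0 <= h ->
  (forall s t, p.1 <= s <= p.1 + w -> p.2 <= t <= p.2 + h ->
    [/\ {for s, continuous (P^~ t)}, {for t, continuous (P s)},
        {for s, continuous (Q^~ t)} & {for t, continuous (Q s)}]) ->
  `|boundary_int P Q p.1 w p.2 h| / 4 <=
  `|boundary_int P Q (quarter P Q w h p).1 (w / 2) (quarter P Q w h p).2 (h / 2)|.
Proof.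
move=> w0 h0 c; rewrite /quarter.
case: ifPn => [//|]; rewrite -ltNge /= => h1.
case: ifPn => [//|]; rewrite -ltNge /= => h2.
case: ifPn => [//|]; rewrite -ltNge /= => h3.
rewrite leNgt; apply/negP => h4; move: h1 h2 h3 h4.
rewrite (boundary_int_split w0 h0 c) => h1 h2 h3 h4.
set a := boundary_int _ _ _ _ _ _ in h1 h2 h3 h4; set b := boundary_int _ _ _ _ _ _ in h1 h2 h3 h4.
set d := boundary_int _ _ _ _ _ _ in h1 h2 h3 h4; set e := boundary_int _ _ _ _ _ _ in h1 h2 h3 h4.
have := ler_normD (a + b + d) e; have := ler_normD (a + b) d; have := ler_normD a b.
lra.
Qed.

(** If the integral were not zero, repeated quartering would produce rectangles
of size 2^-k around a point with boundary integral at least of order 4^-k;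
differentiability at that point makes it o(4^-k). *)
Lemma goursat P Q (x w y h : R) : 0 <= w -> 0 <= h ->
  (forall s t, x <= s <= x + w -> y <= t <= y + h ->
    exists a b d, has_grad P s t a b /\ has_grad Q s t b d) ->
  boundary_int P Q x w y h = 0.
Proof.
move=> w0 h0 H; apply/eqP/negPn/negP; rewrite -normr_gt0.
set I := `|boundary_int _ _ _ _ _ _| => I0.
have c s t : x <= s <= x + w -> y <= t <= y + h ->
    [/\ {for s, continuous (P^~ t)}, {for t, continuous (P s)},
        {for s, continuous (Q^~ t)} & {for t, continuous (Q s)}].
  move=> xs yt; have [a [b [d [dP dQ]]]] := H _ _ xs yt.
  by have [? ?] := has_grad_continuous dP; have [? ?] := has_grad_continuous dQ.
pose wk k : R := w / 2 ^+ k; pose hk k : R := h / 2 ^+ k.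
have wk0 k : 0 <= wk k by rewrite divr_ge0// exprn_ge0.
have hk0 k : 0 <= hk k by rewrite divr_ge0// exprn_ge0.
have wkS k : wk k.+1 = wk k / 2 by rewrite /wk exprS; field; rewrite expf_neq0.
have hkS k : hk k.+1 = hk k / 2 by rewrite /hk exprS; field; rewrite expf_neq0.
pose u := fix u k := if k is j.+1 then quarter P Q (wk j) (hk j) (u j) else (x, y).
have uS k : u k.+1 = quarter P Q (wk k) (hk k) (u k) by [].
have ul k : [/\ (u k).1 <= (u k.+1).1, (u k.+1).1 + wk k.+1 <= (u k).1 + wk k,
    (u k).2 <= (u k.+1).2 & (u k.+1).2 + hk k.+1 <= (u k).2 + hk k].
  have [] := quarter_in P Q (u k) (wk0 k) (hk0 k); rewrite -uS wkS hkS.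
  by move=> /andP[? ?] /andP[? ?]; split; lra.
have [x1 x1P] : exists x1, forall k, (u k).1 <= x1 <= (u k).1 + wk k.
  by apply: nested_intervals => k; [case: (ul k)|case: (ul k)|rewrite lerDl].
have [y1 y1P] : exists y1, forall k, (u k).2 <= y1 <= (u k).2 + hk k.
  by apply: nested_intervals => k; [case: (ul k)|case: (ul k)|rewrite lerDl].
have uin k : [/\ x <= (u k).1, (u k).1 + wk k <= x + w, y <= (u k).2 &
    (u k).2 + hk k <= y + h].
  elim: k => [|k [? ? ? ?]]; first by rewrite /wk /hk /= expr0 !divr1 !lexx.
  by have [? ? ? ?] := ul k; split; lra.
have ck k s t : (u k).1 <= s <= (u k).1 + wk k -> (u k).2 <= t <= (u k).2 + hk k ->
    [/\ {for s, continuous (P^~ t)}, {for t, continuous (P s)},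
        {for s, continuous (Q^~ t)} & {for t, continuous (Q s)}].
  by move=> ? ?; have [? ? ? ?] := uin k; apply: c; lra.
have Ik k : I / 4 ^+ k <= `|boundary_int P Q (u k).1 (wk k) (u k).2 (hk k)|.
  elim: k => [|k IH]; first by rewrite /wk /hk /= expr0 !divr1.
  have := le_boundary_int_quarter (wk0 k) (hk0 k) (@ck k).
  rewrite -uS -wkS -hkS; apply: le_trans.
  rewrite (_ : I / 4 ^+ k.+1 = I / 4 ^+ k / 4) ?ler_pM2r ?invr_gt0//.
  by rewrite exprS; field; rewrite expf_neq0.
have x1i : x <= x1 <= x + w by have := x1P 0%N; rewrite /wk /= divr1.
have y1i : y <= y1 <= y + h by have := y1P 0%N; rewrite /hk /= divr1.
have [a [b [d [dP dQ]]]] := H _ _ x1i y1i.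
(* the k-th integral is at most 2 e (w + h)^2 / 4^k, so this e is too small *)
pose e := I / (4 * ((w + h) ^+ 2 + 1)).
have wh0 : 0 < (w + h) ^+ 2 + 1 by rewrite ltr_wpDl// sqr_ge0.
have e0 : 0 < e by rewrite divr_gt0// mulr_gt0.
have [d1 d10 dP1] := dP _ e0.
have [d2 d20 dQ1] := dQ _ e0.
have [k kd] : exists k, (w + h) / 2 ^+ k < Num.min d1 d2.
  have m0 : 0 < Num.min d1 d2 by rewrite lt_min d10.
  exists (Num.truncn ((w + h) / Num.min d1 d2)).+1.
  rewrite ltr_pdivrMr ?exprn_gt0// mulrC -ltr_pdivrMr//.
  apply: (lt_le_trans (truncnS_gt _)).
  by rewrite -natrX ler_nat ltnW// ltn_expl.
have wd : wk k <= (w + h) / 2 ^+ k by rewrite ler_pM2r ?invr_gt0 ?exprn_gt0// lerDl.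
have hd : hk k <= (w + h) / 2 ^+ k by rewrite ler_pM2r ?invr_gt0 ?exprn_gt0// lerDr.
move: kd; rewrite lt_min => /andP[kd1 kd2].
have B := boundary_int_bound (wk0 k) (hk0 k) (@ck k) (p0 := P x1 y1) (q0 := Q x1 y1)
  (a := a) (b := b) (d := d) (x0 := x1) (y0 := y1) (E := e * (wk k + hk k)).
have {B} : `|boundary_int P Q (u k).1 (wk k) (u k).2 (hk k)| <=
  2 * (e * (wk k + hk k)) * (wk k + hk k).
  apply: B => s t us ut.
  have sx : `|s - x1| <= wk k by have := x1P k; rewrite ler_norml; lra.
  have ty : `|t - y1| <= hk k by have := y1P k; rewrite ler_norml; lra.
  split.
    apply: (le_trans (dP1 s t _ _)); [lra|lra|].
    by rewrite ler_pM2l//; lra.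
  apply: (le_trans (dQ1 s t _ _)); [lra|lra|].
  by rewrite ler_pM2l//; lra.
apply/negP; rewrite -ltNge; apply: lt_le_trans (Ik k).
have -> : 2 * (e * (wk k + hk k)) * (wk k + hk k) = (2 * e * (w + h) ^+ 2) / 4 ^+ k.
  rewrite /wk /hk (_ : (4 : R) = 2 ^+ 2) -?exprM ?natrX; last by rewrite -natrX.
  by rewrite mulnC exprM; field; rewrite expf_neq0.
rewrite ltr_pM2r ?invr_gt0 ?exprn_gt0//.
have : e * (4 * ((w + h) ^+ 2 + 1)) = I by rewrite /e; field; lra.
have := sqr_ge0 (w + h); nra.
Qed.

End Goursat.

(** * Complex differentiability and the mean value property *)

Section ComplexDifferentiability.
Local Open Scope classical_set_scope.

Definition has_cderiv (K : numFieldType) (f : K -> K) (z d : K) :=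
  forall e : K, 0 < e -> exists2 r : K, 0 < r &
    forall w, `|w - z| < r -> `|f w - (f z + d * (w - z))| <= e * `|w - z|.

Lemma derivable_has_cderiv (K : numFieldType) (f : K -> K) (z : K) :
  derivable (f : K^o -> K^o) z 1 -> has_cderiv f z ('D_1 (f : K^o -> K^o) z).
Proof.
move=> df e e0.
have : (fun h : K => h^-1 *: ((f : K^o -> K^o) (h *: (1 : K^o) + z) - f z)) @ 0^' -->
   'D_1 (f : K^o -> K^o) z by exact: df.
move=> /cvgrPdist_le /(_ e e0) [r /= r0 hr]; exists r => // w wr.
have [->|wz] := eqVneq w z; first by rewrite subrr mulr0 addr0 subrr normr0 mulr0.
have wz0 : w - z != 0 by rewrite subr_eq0.
have := hr (w - z); rewrite /= sub0r normrN => /(_ wr wz0).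
rewrite scaler1 subrK => h.
have -> : f w - (f z + 'D_1 (f : K^o -> K^o) z * (w - z)) =
   - (('D_1 (f : K^o -> K^o) z - (w - z)^-1 *: (f w - f z : K^o)) * (w - z)).
  by rewrite /GRing.scale /=; field.
by rewrite normrN normrM ler_pM2r ?normr_gt0.
Qed.

End ComplexDifferentiability.

Section ComplexExponential.
Local Open Scope classical_set_scope.
Local Open Scope complex_scope.

Context {R : realType}.
Local Notation C := R[i].
Local Notation Re := (@complex.Re R).
Local Notation Im := (@complex.Im R).
Implicit Types (s t : R) (z w p : C).

(** The complex exponential of s + i t. *)
Definition cexp s t : C := (expR s * cos t) +i* (expR s * sin t).

Lemma cexpD s t s' t' : cexp (s + s') (t + t') = cexp s t * cexp s' t'.
Proof.
rewrite /cexp expRD cosD sinD; apply/eqP; rewrite eq_complex /=; apply/andP.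
by split; apply/eqP; ring.
Qed.

Lemma normc_cexp s t : `|cexp s t| = (expR s)%:C.
Proof.
rewrite normc_def /=; congr (_ %:C).
rewrite !exprMn -mulrDr cos2Dsin2 mulr1 sqrtr_sqr ger0_norm// expR_ge0.
Qed.

Lemma norm_le_ReIm (z : C) : `|z| <= (`|Re z| + `|Im z|)%:C.
Proof.
have k0 : 0 <= `|Re z| + `|Im z| by rewrite addr_ge0.
rewrite normc_def lecR -(ger0_norm k0) -sqrtr_sqr ler_sqrt ?sqr_ge0//.
rewrite -(real_normK (num_real (Re z))) -(real_normK (num_real (Im z))).
have := normr_ge0 (Re z); have := normr_ge0 (Im z); nra.
Qed.

Lemma Re_le_norm (z : C) (k : R) : `|z| <= k%:C -> `|Re z| <= k.
Proof. by rewrite -lecR; apply: le_trans; exact: normc_ge_Re. Qed.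

Lemma Im_le_norm (z : C) (k : R) : `|z| <= k%:C -> `|Im z| <= k.
Proof.
move=> h; have := @Re_le_norm (z * 'i) k; rewrite ReiNIm normrN; apply.
by rewrite normrM (_ : `|'i%C| = 1) ?mulr1// normc_def /= expr0n add0r expr1n sqrtr1.
Qed.

Lemma real_gt0 (e : C) : 0 < e -> exists2 r : R, 0 < r & e = r%:C.
Proof.
case: e => a b; rewrite ltcE /= => /andP[/eqP -> a0]; exists a => //.
Qed.

Lemma cexp_approx0 (e : R) : 0 < e -> exists2 d : R, 0 < d &
  forall s t, `|s| < d -> `|t| < d ->
    `|cexp s t - (1 + (s +i* t))| <= (e * (`|s| + `|t|))%:C.
Proof.
move=> e0.
pose e1 := Num.min 1 (e / 8).
have e10 : 0 < e1 by rewrite lt_min ltr01 divr_gt0.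
have e11 : e1 <= 1 by rewrite ge_min lexx.
have e1e : 8 * e1 <= e by have : e1 <= e / 8 by [rewrite ge_min lexx orbT]; lra.
clearbody e1.
have h (f : R -> R) (df : R) : is_derive (0 : R) (1 : R) f df ->
    exists2 d : R, 0 < d & forall s, `|s| < d -> `|f s - f 0 - df * s| <= e1 * `|s|.
  move=> fdf; have := @derivable_has_cderiv R f 0 (@ex_derive _ _ _ _ _ _ _ fdf).
  rewrite (@derive_val _ _ _ _ _ _ _ fdf) => /(_ e1 e10)[d d0 hd]; exists d => // s.
  by have := hd s; rewrite !subr0 opprD addrA.
have [d1 d10 h1] := h expR _ (is_derive_expR 0).
have [d2 d20 h2] := h cos _ (is_derive_cos 0).
have [d3 d30 h3] := h sin _ (is_derive_sin 0).
exists (Num.min (Num.min d1 d2) (Num.min d3 e1)).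
  by rewrite !lt_min d10 d20 d30.
move=> s t; rewrite !lt_min => /andP[/andP[s1 s2] /andP[s3 s4]].
move=> /andP[/andP[t1 t2] /andP[t3 t4]].
have := h1 s s1; have := h2 t t2; have := h3 t t3.
rewrite expR0 sin0 cos0 oppr0 mul0r !subr0 ?addr0 !mul1r => segint cost exps.
apply: (le_trans (norm_le_ReIm _)); rewrite lecR /=.
have es3 : `|expR s - 1| <= 2 * `|s|.
  have -> : expR s - 1 = (expR s - 1 - s) + s by ring.
  rewrite (le_trans (ler_normD _ _))//.
  have := normr_ge0 s; nra.
have es4 : expR s <= 3.
  have := ler_norm (expR s - 1); have := normr_ge0 s; nra.
have es0 := expR_ge0 s.
have t0 := normr_ge0 t; have s0 := normr_ge0 s.
have A : `|expR s * cos t - (1 + s)| <= e1 * `|s| + 3 * (e1 * `|t|).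
  have -> : expR s * cos t - (1 + s) = (expR s - 1 - s) + expR s * (cos t - 1) by ring.
  rewrite (le_trans (ler_normD _ _))// lerD// normrM ger0_norm//.
  by rewrite ler_pM.
have B : `|expR s * sin t - (0 + t)| <= 3 * (e1 * `|t|) + (2 * e1) * `|t|.
  have -> : expR s * sin t - (0 + t) = expR s * (sin t - t) + (expR s - 1) * t by ring.
  rewrite (le_trans (ler_normD _ _))// lerD// normrM ?(ger0_norm es0)//.
    by rewrite ler_pM ?normr_ge0.
  by rewrite ler_wpM2r//; lra.
have : e1 * 8 * (`|s| + `|t|) <= e * (`|s| + `|t|) by rewrite ler_wpM2r ?addr_ge0//; lra.
nra.
Qed.

End ComplexExponential.

Section MeanValue.
Local Open Scope classical_set_scope.
Local Open Scope complex_scope.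

Context {R : realType}.
Local Notation C := R[i].
Local Notation Re := (@complex.Re R).
Local Notation Im := (@complex.Im R).
Implicit Types (s t : R) (z w p : C).

Lemma normcR z : `|z| = (normc z)%:C.
Proof. by []. Qed.

Lemma realC_gt0 (r : R) : 0 < r -> 0 < r%:C.
Proof. by rewrite (ltcR 0). Qed.

Lemma normc_pos (u : R) : 0 < u -> normc (u%:C) = u.
Proof. by move=> u0; rewrite /normc /= expr0n addr0 sqrtr_sqr gtr0_norm. Qed.

Lemma normc_cexpR s t : normc (cexp s t) = expR s.
Proof. by apply: complexI; rewrite -normcR normc_cexp. Qed.

Lemma normc_ge0 z : 0 <= normc z.
Proof. by rewrite -lecR -normcR normr_ge0. Qed.

Lemma normc_le_ReIm z : normc z <= `|Re z| + `|Im z|.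
Proof. by rewrite -lecR -normcR norm_le_ReIm. Qed.

Lemma comp_cexp_approx (g : C -> C) p s t (D : C) (e : R) : 0 < e ->
  has_cderiv g (p + cexp s t) D ->
  exists2 d : R, 0 < d & forall s' t', `|s' - s| < d -> `|t' - t| < d ->
   normc (g (p + cexp s' t') - (g (p + cexp s t) +
     D * cexp s t * ((s' - s) +i* (t' - t)))) <=
     e * (`|s' - s| + `|t' - t|).
Proof.
move=> e0 gD; set z := p + cexp s t; set E := cexp s t.
have x0 := expR_gt0 s; set x := expR s in x0.
have D0 := normc_ge0 D.
pose e1 := Num.min 1 (e / (2 * (normc D * x + 1))).
have q0 : 0 < 2 * (normc D * x + 1) by rewrite mulr_gt0// ltr_wpDl// mulr_ge0// ltW.
have e10 : 0 < e1 by rewrite lt_min ltr01 divr_gt0.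
have e11 : e1 <= 1 by rewrite ge_min lexx.
have e1e : e1 * (2 * (normc D * x + 1)) <= e.
  by rewrite -ler_pdivlMr// ge_min lexx orbT.
pose e2 := e / (4 * x).
have e20 : 0 < e2 by rewrite divr_gt0// mulr_gt0.
have e2e : e2 * x * 4 = e by rewrite /e2; field; rewrite gt_eqF.
clearbody e1 e2.
have [r r0 hr] := gD e2%:C (realC_gt0 e20).
have [rr rr0 rE] := real_gt0 r0.
have [d1 d10 h1] := cexp_approx0 e10.
exists (Num.min d1 (rr / (4 * x))).
  by rewrite lt_min d10 divr_gt0// mulr_gt0.
move=> s' t'; rewrite !lt_min => /andP[s1 s2] /andP[t1 t2].
set a := s' - s in s1 s2 *; set b := t' - t in t1 t2 *.
set k := `|a| + `|b|.
have k0 : 0 <= k by rewrite addr_ge0.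
have EE : cexp s' t' = E * cexp a b.
  by rewrite -cexpD /a /b; congr cexp; ring.
have h2 := h1 a b s1 t1; rewrite normcR lecR -/k in h2.
have h3 : normc (a +i* b) <= k by exact: normc_le_ReIm.
have wz : p + cexp s' t' - z = E * ((cexp a b - (1 + (a +i* b))) + (a +i* b)).
  by rewrite EE /z -/E; ring.
have nwz : normc (p + cexp s' t' - z) <= 2 * x * k.
  rewrite wz normcM normc_cexpR -/x.
  rewrite (_ : 2 * x * k = x * (2 * k)); last by ring.
  rewrite ler_pM2l// (le_trans (le_normcD _ _))//.
  have : e1 * k <= k by rewrite ler_piMl.
  lra.
have {}hr : normc (g (p + cexp s' t') - (g z + D * (p + cexp s' t' - z))) <= e / 2 * k.
  have : e2 * normc (p + cexp s' t' - z) <= e / 2 * k.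
    by rewrite -e2e; nra.
  apply: le_trans; rewrite -lecR -normcR rmorphM /= -normcR; apply: hr.
  rewrite normcR rE ltcR; apply: le_lt_trans nwz _.
  have k1 : k < rr / (2 * x).
    rewrite (_ : rr / (2 * x) = rr / (4 * x) + rr / (4 * x)); first exact: ltrD.
    by field; rewrite gt_eqF.
  by rewrite ltr_pdivlMr ?mulr_gt0// mulrC in k1.
have -> : g (p + cexp s' t') - (g z + D * E * (a +i* b)) =
  (g (p + cexp s' t') - (g z + D * (p + cexp s' t' - z))) +
   D * E * (cexp a b - (1 + (a +i* b))).
  by rewrite wz; ring.
rewrite (le_trans (le_normcD _ _))// !normcM normc_cexpR -/x.
have : normc D * x * normc (cexp a b - (1 + (a +i* b))) <= normc D * x * (e1 * k).
  by rewrite ler_wpM2l// mulr_ge0// ltW.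
have : e1 * (2 * (normc D * x + 1)) * k <= e * k by rewrite ler_wpM2r.
have : 0 <= e1 * k by rewrite mulr_ge0// ltW.
nra.
Qed.

(** The Cauchy-Riemann equations for g in logarithmic polar coordinates at p: the
derivative of the imaginary part in t is that of the real part in s, as
required by [goursat]. *)
Lemma comp_cexp_has_grad (g : C -> C) p s t (D : C) :
  has_cderiv g (p + cexp s t) D ->
  let D' := D * cexp s t in
  has_grad (fun s t => Im (g (p + cexp s t))) s t (Im D') (Re D') /\
  has_grad (fun s t => Re (g (p + cexp s t))) s t (Re D') (- Im D').
Proof.
move=> gD D'; split=> e e0; have [d d0 h] := comp_cexp_approx e0 gD;
  exists d => // s' t' s's t't; have := h s' t' s's t't;
  rewrite -/D' -lecR -normcR => {}h.
- move/Im_le_norm : h; congr (`|_| <= _).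
  case: D' => u v; case: (g _) => ? ?; case: (g _) => ? ? /=; ring.
- move/Re_le_norm : h; congr (`|_| <= _).
  case: D' => u v; case: (g _) => ? ?; case: (g _) => ? ? /=; ring.
Qed.

(** The mean of Re g over a circle around p is Re (g p).  Indeed, by [goursat] on
a strip of height 2 pi, whose horizontal sides cancel by periodicity, the
integral of Re g over the circle of radius exp(x) does not depend on x, and it
tends to 2 pi Re (g p) as x tends to minus infinity. *)
Lemma circle_value_gt (g : C -> C) p (r eta : R) : 0 < r -> 0 < eta ->
  (forall z, `|z - p| <= r%:C -> exists D, has_cderiv g z D) ->
  exists2 z, `|z - p| = r%:C & Re (g p) - eta < Re (g z).
Proof.
move=> r0 eta0 gD; apply: contrapT => /forall2NP H.
have {}H t : Re (g (p + cexp (ln r) t)) <= Re (g p) - eta.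
  case: (H (p + cexp (ln r) t)).
    by rewrite addrAC subrr add0r normc_cexp lnK ?posrE.
  by move=> /negP; rewrite -leNgt.
have [|D gpD] := gD p; first by rewrite subrr normr0 ltW// realC_gt0.
have [rr rr0 hr] : exists2 rr : R, 0 < rr &
    forall z, normc (z - p) < rr -> Re (g p) - eta / 2 <= Re (g z).
  have [r1 r10 hr1] := gpD 1 ltr01.
  have [r2 r20 r1E] := real_gt0 r10.
  have D0 := normc_ge0 D.
  exists (Num.min r2 (eta / (2 * (1 + normc D)))).
    by rewrite lt_min r20 divr_gt0// mulr_gt0// ltr_pwDl.
  move=> z; rewrite lt_min => /andP[z1 z2].
  have := hr1 z; rewrite r1E normcR ltcR => /(_ z1).
  rewrite mul1r normcR lecR => gz.
  have : normc (g z - g p) <= (1 + normc D) * normc (z - p).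
    rewrite (_ : g z - g p = (g z - (g p + D * (z - p))) + D * (z - p)); last by ring.
    by rewrite (le_trans (le_normcD _ _))// normcM mulrDl mul1r lerD.
  rewrite -lecR -normcR => /Re_le_norm; rewrite raddfB /= ler_norml => /andP[+ _].
  rewrite ltr_pdivlMr in z2; last by rewrite mulr_gt0// ltr_pwDl.
  lra.
(* on the circle of radius exp r1 the function is within eta / 2 of its centre *)
pose r1 := Num.min (ln r) (ln rr - 1).
have r1r : r1 <= ln r by rewrite ge_min lexx.
have r1rr : expR r1 < rr.
  rewrite -[ltRHS]lnK ?posrE// ltr_expR (@le_lt_trans _ _ (ln rr - 1))//.
    by rewrite ge_min lexx orbT.
  by rewrite gtrBl.
have pi0 := pi_gt0 R.
pose P s t := Im (g (p + cexp s t)); pose Q s t := Re (g (p + cexp s t)).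
have PQ s t : s <= ln r -> exists a b d, has_grad P s t a b /\ has_grad Q s t b d.
  move=> sr; have [|D' gD'] := gD (p + cexp s t).
    by rewrite addrAC subrr add0r normc_cexp lecR -[leRHS]lnK ?posrE// ler_expR.
  by have [? ?] := comp_cexp_has_grad gD'; do 3 eexists; split; eassumption.
have : boundary_int P Q r1 (ln r - r1) 0 (2 * pi) = 0.
  apply: goursat => [||s t /andP[_ sr] _]; [lra|lra|].
  by apply: PQ; rewrite subrKC in sr.
rewrite /boundary_int subrKC add0r.
have -> : P^~ (2 * pi) = P^~ 0.
  apply/funext => s; rewrite /P; congr (Im (g (p + _))).
  by rewrite /cexp mulr_natl cos2pi sin2pi cos0 sin0.
rewrite subrr add0r.
have cQ s : s <= ln r -> continuous_on (Q s) 0 (2 * pi).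
  move=> sr t _; have [a [b [d [_ dQ]]]] := PQ s t sr.
  by have [] := has_grad_continuous dQ.
have pp : 0 <= 2 * pi :> R by lra.
have : segint (Q (ln r)) 0 (2 * pi) <= (Re (g p) - eta) * (2 * pi - 0).
  by apply: segint_le => //; [exact: cQ|move=> t _; exact: H].
have : (Re (g p) - eta / 2) * (2 * pi - 0) <= segint (Q r1) 0 (2 * pi).
  apply: segint_ge => //; [exact: cQ|move=> t _; apply: hr].
  by rewrite addrAC subrr add0r normc_cexpR.
nra.
Qed.
End MeanValue.

(** * The maximum principle and Schwarz's lemma *)

Section MaxPrinciple.
Local Open Scope classical_set_scope.
Local Open Scope complex_scope.

Context {R : realType}.
Local Notation C := R[i].
Local Notation Re := (@complex.Re R).
Local Notation Im := (@complex.Im R).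
Implicit Types (s t : R) (z w p : C).

Lemma lipschitz_at_continuous2 (f : R * R -> R) q d k : 0 < d ->
  (forall q', `|q'.1 - q.1| < d -> `|q'.2 - q.2| < d ->
     `|f q' - f q| <= k * (`|q'.1 - q.1| + `|q'.2 - q.2|)) ->
  {for q, continuous f}.
Proof.
move=> d0 H; apply/cvgrPdist_le => /= e e0.
have k0 : 0 < `|k| + 1 by rewrite ltr_wpDl.
pose m := Num.min d (e / (2 * (`|k| + 1))).
have m0 : 0 < m by rewrite lt_min d0 divr_gt0// mulr_gt0.
exists (ball q.1 m, ball q.2 m) => /=; first by split; exact: nbhsx_ballx.
move=> q' /= []; rewrite /ball /= (distrC _ q'.1) (distrC _ q'.2) !lt_min => /andP[a1 a2] /andP[b1 b2].
rewrite distrC (le_trans (H _ a1 b1))//.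
rewrite ltr_pdivlMr in a2; last by rewrite mulr_gt0.
rewrite ltr_pdivlMr in b2; last by rewrite mulr_gt0.
have := ler_norm k; have := normr_ge0 (q'.1 - q.1); have := normr_ge0 (q'.2 - q.2).
nra.
Qed.

Lemma normc_dist z w : `|normc z - normc w| <= normc (z - w).
Proof.
have h1 := le_normcD (z - w) w; have h2 := le_normcD (w - z) z.
rewrite !subrK -[normc (w - z)]normcN opprB in h1 h2.
by rewrite ler_norml; lra.
Qed.

Lemma has_cderiv_normc_continuous (g : C -> C) (q : R * R) D :
  has_cderiv g (q.1 +i* q.2) D ->
  {for q, continuous (fun q : R * R => normc (g (q.1 +i* q.2)))}.
Proof.
move=> /(_ 1 ltr01)[r r0]; have [d d0 ->] := real_gt0 r0 => hr.
apply: (@lipschitz_at_continuous2 _ q (d / 2) (1 + normc D)); first by rewrite divr_gt0.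
move=> q' q1 q2; apply: (le_trans (normc_dist _ _)).
set z := q.1 +i* q.2; set w := q'.1 +i* q'.2.
have wz : normc (w - z) <= `|q'.1 - q.1| + `|q'.2 - q.2| by exact: normc_le_ReIm.
have := hr w; rewrite normcR ltcR => /(_ (ltac:(lra))).
rewrite mul1r normcR lecR => gw.
rewrite (_ : g w - g z = (g w - (g z + D * (w - z))) + D * (w - z)); last by ring.
rewrite (le_trans (le_normcD _ _))// normcM.
by have := normc_ge0 D; nra.
Qed.

Lemma normc_sqr z : normc z ^+ 2 = Re z ^+ 2 + Im z ^+ 2.
Proof. by case: z => a b /=; rewrite sqr_sqrtr// addr_ge0 ?sqr_ge0. Qed.

Lemma has_cderiv_affine (g : C -> C) a b p z D : has_cderiv g z D ->
  has_cderiv (fun z => a * g z + b * (z - p)) z (a * D + b).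
Proof.
move=> gD e e0.
have a0 : 0 < `|a| + 1 by rewrite ltr_wpDl.
have [|r r0 hr] := gD (e / (`|a| + 1)); first by rewrite divr_gt0.
exists r => // w wr.
have -> : a * g w + b * (w - p) - (a * g z + b * (z - p) + (a * D + b) * (w - z)) =
  a * (g w - (g z + D * (w - z))) by ring.
rewrite normrM (le_trans (ler_wpM2l _ (hr w wr)))//.
rewrite mulrA ler_wpM2r// mulrCA ler_piMr// ?ltW//.
by rewrite ltr_pdivrMr// mul1r ltrDl.
Qed.

(** If |g| exceeded M at some point, then u = |g|^2 + e |z|^2 with a small e > 0
would have an interior maximum point P on a disk of radius close to 1.  On a
small circle around P one has Re (G z) <= Re (G P) - e rho^2 / 2 for
G z = conj(g P) g z + e conj(P) (z - P), against [circle_value_gt].  The term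
e |z|^2 supplies the strict inequality that |g| alone does not give. *)
Lemma max_principle (g : C -> C) (M : R) : 0 <= M ->
  (forall z, normc z < 1 -> exists D, has_cderiv g z D) ->
  (forall e : R, 0 < e -> exists2 r0 : R, r0 < 1 &
     forall z, r0 < normc z -> normc z < 1 -> normc (g z) <= M + e) ->
  forall z, normc z < 1 -> normc (g z) <= M.
Proof.
move=> M0 gD gM z0 z01; rewrite leNgt; apply/negP => Mz0.
set m0 := normc (g z0) in Mz0.
pose e := Num.min 1 ((m0 ^+ 2 - M ^+ 2) / (2 * M + 3)).
have mM : 0 < m0 ^+ 2 - M ^+ 2 by nra.
have e0 : 0 < e by rewrite lt_min ltr01 divr_gt0// ltr_wpDl// mulr_ge0.
have e1 : e <= 1 by rewrite ge_min lexx.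
have eM : e * (2 * M + 3) <= m0 ^+ 2 - M ^+ 2.
  by rewrite -ler_pdivlMr ?ge_min ?lexx ?orbT// ltr_wpDl// mulr_ge0.
have eM2 : (M + e) ^+ 2 + e < m0 ^+ 2 by nra.
clearbody e.
have [r0 r01 hr0] := gM e e0.
pose r := (Num.max r0 (normc z0) + 1) / 2.
have rz : normc z0 < r /\ r0 < r /\ r < 1.
  have : normc z0 <= Num.max r0 (normc z0) by rewrite le_max lexx orbT.
  have : r0 <= Num.max r0 (normc z0) by rewrite le_max lexx.
  have : Num.max r0 (normc z0) < 1 by rewrite gt_max r01.
  rewrite /r; lra.
case: rz => z0r [r0r r1].
have rge0 : 0 <= r by rewrite ltW// (le_lt_trans (normc_ge0 _) z0r).
pose u (q : R * R) : R := normc (g (q.1 +i* q.2)) ^+ 2 + e * (q.1 ^+ 2 + q.2 ^+ 2).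
pose K : set (R * R) := [set q | q.1 ^+ 2 + q.2 ^+ 2 <= r ^+ 2].
have normE (q : R * R) : normc (q.1 +i* q.2) ^+ 2 = q.1 ^+ 2 + q.2 ^+ 2 by rewrite normc_sqr.
have normr (q : R * R) : K q <-> normc (q.1 +i* q.2) <= r.
  apply: (@iff_trans _ (normc (q.1 +i* q.2) ^+ 2 <= r ^+ 2)); first by rewrite normE.
  by rewrite ler_sqr ?nnegrE ?normc_ge0.
have cs (q : R * R) : {for q, continuous (fun q : R * R => q.1 ^+ 2 + q.2 ^+ 2)}.
  apply: (@continuousD _ _ _ (fun q : R * R => q.1 ^+ 2) (fun q : R * R => q.2 ^+ 2)).
    by apply: (@continuousM _ _ (fun q : R * R => q.1) (fun q => q.1)); exact: cvg_fst.
  by apply: (@continuousM _ _ (fun q : R * R => q.2) (fun q => q.2)); exact: cvg_snd.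
have cK : compact K.
  apply: (@subclosed_compact _ _ (`[-r, r] `*` `[-r, r])).
  - rewrite (_ : K = (fun q : R * R => q.1 ^+ 2 + q.2 ^+ 2) @^-1` [set x | x <= r ^+ 2])//.
    apply: closed_comp; last exact: closed_le.
    by move=> q _; exact: cs.
  - by apply: compact_setX; exact: segment_compact.
  - by move=> [x y]; rewrite /K /= !in_itv /= => h; split; nra.
have cu : {within K, continuous u}.
  apply: continuous_in_subspaceT => q; rewrite inE => /normr qr.
  have [|D gq] := gD (q.1 +i* q.2); first by lra.
  have cn := has_cderiv_normc_continuous gq.
  apply: (@continuousD _ _ _ (fun q : R * R => normc (g (q.1 +i* q.2)) ^+ 2)
     (fun q : R * R => e * (q.1 ^+ 2 + q.2 ^+ 2))).
    by apply: (@continuousM _ _ (fun q : R * R => normc (g (q.1 +i* q.2)))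
      (fun q : R * R => normc (g (q.1 +i* q.2)))).
  by apply: (@continuousM _ _ (fun=> e) (fun q : R * R => (q.1 ^+ 2 + q.2 ^+ 2)));
    [exact: cst_continuous|exact: cs].
have zK : K (Re z0, Im z0) by apply/normr; case: (z0) z0r => a b /= /ltW.
have [p] := compact_EVT_max (ex_intro _ _ zK) cK cu.
rewrite inE => pK pmax.
have uz : u (Re z0, Im z0) <= u p by apply: pmax; rewrite inE.
have m0u : m0 ^+ 2 <= u p.
  apply: le_trans uz.
  rewrite (_ : u _ = m0 ^+ 2 + e * (Re z0 ^+ 2 + Im z0 ^+ 2)).
    by rewrite lerDl mulr_ge0// ?addr_ge0 ?sqr_ge0// ltW.
  by congr (normc (g _) ^+ 2 + _); case: (z0).
have pr := (normr p).1 pK; move: pr; rewrite le_eqVlt => /orP[/eqP pr|pr].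
  have := hr0 (p.1 +i* p.2); rewrite pr => /(_ r0r r1) gp.
  have := normc_ge0 (g (p.1 +i* p.2)).
  have : u p <= normc (g (p.1 +i* p.2)) ^+ 2 + e * r ^+ 2.
    by rewrite /u lerD2l ler_pM2l.
  have : e * r ^+ 2 <= e by rewrite ler_piMr ?(ltW e0)// expr_le1// ltW.
  set n := normc _ in gp *; move=> er un n0.
  have : n ^+ 2 <= (M + e) ^+ 2 by rewrite ler_sqr ?nnegrE// (le_trans n0).
  lra.
pose rho := r - normc (p.1 +i* p.2).
have rho0 : 0 < rho by rewrite subr_gt0.
pose P := p.1 +i* p.2.
have nz z : `|z - P| <= rho%:C -> normc z <= r.
  rewrite normcR lecR => zP; have := le_normcD (z - P) P.
  by rewrite subrK; rewrite /rho -/P in zP; lra.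
have [||z zP zlt] := @circle_value_gt _
    (fun z => (g P)^* * g z + (e%:C * P^*) * (z - P)) P rho (e * rho ^+ 2 / 2) rho0.
- by rewrite divr_gt0// mulr_gt0// exprn_gt0.
- move=> z zP; have [|D gzD] := gD z; first by have := nz z zP; lra.
  by exists ((g P)^* * D + e%:C * P^*); exact: has_cderiv_affine.
have zr : normc z <= r by apply: nz; rewrite zP.
have uzp : u (Re z, Im z) <= u p.
  by apply: pmax; rewrite inE; apply/normr; case: (z) zr.
have zP2 : normc (z - P) ^+ 2 = rho ^+ 2 by congr (_ ^+ 2); apply: complexI.
have {uzp} : Re (g z) ^+ 2 + Im (g z) ^+ 2 + e * (Re z ^+ 2 + Im z ^+ 2) <=
    Re (g P) ^+ 2 + Im (g P) ^+ 2 + e * (Re P ^+ 2 + Im P ^+ 2).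
  by rewrite -!normc_sqr; move: uzp; rewrite /u -!normE; case: (z).
move: zlt zP2; rewrite normc_sqr subrr mulr0 addr0.
case: (g P) => a b; case: (g z) => c d; case: (z) => x1 y1; rewrite /P.
case: (p) => x y /= zlt zP2.
have := congr1 ( *%R e) zP2; have := sqr_ge0 (a - c); have := sqr_ge0 (b - d).
move: zlt; clear; nra.
Qed.

End MaxPrinciple.

Section Hol.
Local Open Scope classical_set_scope.
Local Open Scope complex_scope.

Context {R : realType}.
Local Notation C := R[i].
Implicit Types (f g : C -> C) (z : C).

Definition hol f z := derivable (f : C^o -> C^o) z 1.

Lemma hol_cst (k : C) z : hol (fun=> k) z.
Proof. exact: derivable_cst. Qed.

Lemma hol_id z : hol id z.
Proof. exact: derivable_id. Qed.

Lemma holD f g z : hol f z -> hol g z -> hol (fun z => f z + g z) z.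
Proof. exact: derivableD. Qed.

Lemma holN f z : hol f z -> hol (fun z => - f z) z.
Proof. exact: derivableN. Qed.

Lemma holM f g z : hol f z -> hol g z -> hol (fun z => f z * g z) z.
Proof. exact: derivableM. Qed.

Lemma holV f z : f z != 0 -> hol f z -> hol (fun z => (f z)^-1) z.
Proof. exact: derivableV. Qed.

Lemma holX f n z : hol f z -> hol (fun z => f z ^+ n) z.
Proof.
move=> hf; elim: n => [|n IH].
  by under eq_fun do rewrite expr0; exact: hol_cst.
by under eq_fun do rewrite exprS; exact: holM.
Qed.

Lemma hol_prod (s : seq C) z : hol (fun z => \prod_(p <- s) (z - p)) z.
Proof.
elim: s => [|p s IH].
  by under eq_fun do rewrite big_nil; exact: hol_cst.
have h1 : hol (fun z => z - p) z.
  exact: (@holD id (fun=> - p) z (@hol_id z) (@hol_cst (- p) z)).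
have := @holM _ _ _ h1 IH.
by under [X in _ -> hol X _]eq_fun do rewrite big_cons.
Qed.

(** Bernoulli's inequality makes the powers of x unbounded when x > 1. *)
Lemma bounded_powers_le1 (x K : R) : 0 <= x -> (forall m, x ^+ m <= K) -> x <= 1.
Proof.
move=> x0 h; rewrite leNgt; apply/negP => x1.
have b m : 1 + (x - 1) * m%:R <= x ^+ m.
  elim: m => [|m IH]; first by rewrite mulr0 addr0 expr0.
  rewrite exprS -natr1; have m0 : 0 <= m%:R :> R by [].
  have := ler_wpM2l x0 IH; have : 0 <= (x - 1) ^+ 2 * m%:R by apply: mulr_ge0 => //; exact: sqr_ge0.
  lra.
have := b (Num.truncn (K / (x - 1))).+1.
have : K < (x - 1) * (Num.truncn (K / (x - 1))).+1%:R.
  by rewrite mulrC -ltr_pdivrMr ?subr_gt0// truncnS_gt.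
have := h (Num.truncn (K / (x - 1))).+1.
lra.
Qed.

Lemma prod_sub_bound (s : seq C) z : normc z < 1 ->
  normc (\prod_(p <- s) (z - p)) <= \prod_(p <- s) (1 + normc p).
Proof.
move=> z1; elim: s => [|p s IH]; first by rewrite !big_nil normc1.
rewrite !big_cons normcM ler_pM ?normc_ge0//.
rewrite (le_trans (le_normcD _ _))// [normc (- p)]normcN lerD2r; exact: ltW.
Qed.

Lemma normcX z n : normc (z ^+ n) = normc z ^+ n.
Proof. by elim: n => [|n IH]; rewrite ?expr0 ?normc1// !exprS normcM IH. Qed.

Lemma normc_conj z : normc (z^*) = normc z.
Proof. by apply: complexI; rewrite -!normcR normcJ. Qed.

Lemma blaschke_identity (a z : C) :
  normc (1 - a^* * z) ^+ 2 - normc (z - a) ^+ 2 = (1 - normc a ^+ 2) * (1 - normc z ^+ 2).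
Proof. by rewrite !normc_sqr; case: a => a b; case: z => x y /=; ring. Qed.

(** Schwarz's lemma with a finite exceptional set s, near which f is only bounded.
For Q the product of the z - p with p in s, the function f^m Q^2 vanishes to
second order on s, hence is differentiable on the whole disk.  Near the unit
circle |f| <= 1 + d, so the maximum principle gives |f|^m |Q|^2 <= (1 + d)^m B
with B independent of m; now let m tend to infinity. *)
Lemma schwarz_exceptional (a : C) (f : C -> C) (s : seq C) (K : R) :
  normc a < 1 ->
  (forall z, normc z < 1 -> z \notin s -> hol f z) ->
  (forall z, normc z < 1 -> z \notin s -> normc (f z) <= K) ->
  (forall z, normc z < 1 -> z \notin s ->
     normc (f z) * normc (z - a) <= normc (1 - a^* * z)) ->
  forall z, normc z < 1 -> z \notin s -> normc (f z) <= 1.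
Proof.
move=> a1 hf fK fa z0 z01 z0s.
apply/ler_addgt0Pr => d d0.
pose Q z := \prod_(p <- s) (z - p).
pose B := (\prod_(p <- s) (1 + normc p)) ^+ 2.
have P0 (t : seq C) : 0 <= \prod_(p <- t) (1 + normc p).
  by apply: prodr_ge0 => p _; rewrite addr_ge0// normc_ge0.
have B0 : 0 <= B by exact: sqr_ge0.
have QB z : normc z < 1 -> normc (Q z ^+ 2) <= B.
  by move=> z1; rewrite normcX ler_sqr ?nnegrE ?normc_ge0// prod_sub_bound.
have Q0 z : z \in s -> Q z = 0.
  by move=> zs; rewrite /Q (big_rem z zs) /= subrr mul0r.
have d1 : 0 < 1 + d by rewrite ltr_wpDl.
have K0 : 0 <= K by rewrite (le_trans _ (fK _ z01 z0s))// normc_ge0.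
(* |z - a| is close to |1 - conj(a) z| when |z| is close to 1 *)
have near_bd : exists2 r0 : R, r0 < 1 & forall z, r0 < normc z -> normc z < 1 ->
    z \notin s -> normc (f z) <= 1 + d.
  have a0 := normc_ge0 a.
  pose k := Num.min (1 - normc a) (d * (1 - normc a) ^+ 2).
  have k0 : 0 < k by rewrite lt_min subr_gt0 a1 mulr_gt0// exprn_gt0// subr_gt0.
  have ka : k <= 1 - normc a by rewrite ge_min lexx.
  have kd : k <= d * (1 - normc a) ^+ 2 by rewrite ge_min lexx orbT.
  exists (1 - k / 4); first by rewrite gtrBl divr_gt0.
  move=> z zk z1 zs; have := fa z z1 zs; have := blaschke_identity a z.
  have za : (1 - normc a) / 2 <= normc (z - a).
    have := le_normcD (z - a) a; rewrite subrK; lra.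
  have := normc_ge0 (f z).
  move: za; set u := normc (f z); set v := normc (z - a); set w := normc (1 - _).
  move: (normc a) a0 a1 ka kd zk => na na0 na1 ka kd; move: (normc z) z1 => nz nz1 nzk.
  move=> va u0 E uvw; rewrite leNgt; apply/negP => ud.
  have v0 : 0 < v by lra.
  have h1 : (u * v) ^+ 2 <= w ^+ 2 by rewrite ler_sqr ?nnegrE ?(le_trans _ uvw)// mulr_ge0// ltW.
  have h2 : (1 + d) ^+ 2 * v ^+ 2 < (u * v) ^+ 2.
    by rewrite exprMn ltr_pM2r ?exprn_gt0// ltr_sqr ?nnegrE//; lra.
  have h3 : d * v ^+ 2 <= d ^+ 2 * v ^+ 2 + d * v ^+ 2.
    by rewrite lerDr mulr_ge0// sqr_ge0.
  have h4 : ((1 - na) / 2) ^+ 2 <= v ^+ 2 by rewrite ler_sqr ?nnegrE; lra.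
  have h5 : d * ((1 - na) / 2) ^+ 2 <= d * v ^+ 2 by rewrite ler_pM2l.
  have h6 : (1 - na ^+ 2) * (1 - nz ^+ 2) <= 1 - nz ^+ 2.
    have : 0 <= na ^+ 2 by exact: sqr_ge0.
    have : 0 <= 1 - nz ^+ 2 by nra.
    nra.
  have h7 : 1 - nz ^+ 2 <= 2 * (k / 4) by nra.
  lra.
have key m : (normc (f z0) / (1 + d)) ^+ m * normc (Q z0 ^+ 2) <= B.
  have : normc (f z0 ^+ m * Q z0 ^+ 2) <= (1 + d) ^+ m * B.
    have [r0 r01 hr0] := near_bd.
    apply: (@max_principle _ (fun z => f z ^+ m * Q z ^+ 2)) => //.
    - by rewrite mulr_ge0// exprn_ge0// ltW.
    - move=> z z1; have [zs|zs] := boolP (z \in s); last first.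
        eexists; apply: derivable_has_cderiv.
        exact: (@holM _ _ _ (@holX _ m _ (hf z z1 zs)) (@holX _ 2 _ (@hol_prod s z))).
      (* at an exceptional point the function is O((w - z)^2) *)
      exists 0 => e /real_gt0[e' e'0 ->].
      pose B1 := K ^+ m * (\prod_(p <- rem z s) (1 + normc p)) ^+ 2.
      have B10 : 0 <= B1 by rewrite mulr_ge0// ?exprn_ge0// sqr_ge0.
      pose r := Num.min (1 - normc z) (e' / (B1 + 1)).
      have r0' : 0 < r by rewrite lt_min subr_gt0 z1 divr_gt0// ltr_wpDl.
      exists r%:C; first exact: realC_gt0.
      move=> w; rewrite !normcR ltcR -rmorphM lecR lt_min => /andP[wz we].
      rewrite (Q0 z zs) expr0n mulr0 mul0r addr0 subr0.
      have w1 : normc w < 1 by have := le_normcD (w - z) z; rewrite subrK; lra.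
      have [ws|ws] := boolP (w \in s).
        by rewrite (Q0 w ws) expr0n mulr0 normc0 mulr_ge0 ?normc_ge0// ltW.
      rewrite normcM !normcX.
      have QE : normc (Q w) <= normc (w - z) * \prod_(p <- rem z s) (1 + normc p).
        rewrite /Q (big_rem z zs) /= normcM ler_wpM2l ?normc_ge0//.
        exact: prod_sub_bound.
      have : normc (f w) ^+ m * normc (Q w) ^+ 2 <= B1 * normc (w - z) ^+ 2.
        rewrite /B1 -mulrA ler_pM ?exprn_ge0 ?normc_ge0//.
          by rewrite lerXn2r ?nnegrE ?normc_ge0 ?fK.
        rewrite -exprMn mulrC ler_sqr ?nnegrE ?normc_ge0//.
        by rewrite mulr_ge0 ?normc_ge0.
      move/le_trans; apply; rewrite expr2 mulrA ler_wpM2r ?normc_ge0//.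
      rewrite ltr_pdivlMr ?ltr_wpDl// in we.
      by have := normc_ge0 (w - z); lra.
    - move=> e e0; exists r0 => // z zr z1.
      have [zs|zs] := boolP (z \in s).
        rewrite (Q0 z zs) expr0n mulr0 normc0 addr_ge0// ?(ltW e0)//.
        by rewrite mulr_ge0// exprn_ge0// ltW.
      rewrite (@le_trans _ _ ((1 + d) ^+ m * B)) ?lerDl ?(ltW e0)//.
      rewrite normcM ler_pM ?normc_ge0 ?QB// normcX.
      by rewrite lerXn2r ?nnegrE ?normc_ge0 ?hr0// ltW.
  rewrite normcM normcX expr_div_n mulrAC ler_pdivrMr ?exprn_gt0//.
  by rewrite [leRHS]mulrC.
have Qz0 : 0 < normc (Q z0 ^+ 2).
  rewrite lt_neqAle normc_ge0 andbT eq_sym; apply/eqP => /eq0_normc/eqP.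
  rewrite expf_eq0 /= => /eqP h; move: z0s; apply/negP; rewrite negbK.
  have /eqP := h; rewrite /Q prodf_seq_eq0 => /hasP[p ps /=].
  by rewrite subr_eq0 => /eqP ->.
have := @bounded_powers_le1 (normc (f z0) / (1 + d)) (B / normc (Q z0 ^+ 2)).
rewrite divr_ge0 ?normc_ge0 ?(ltW d1)// => /(_ isT).
rewrite ler_pdivrMr// mul1r; apply => m.
by rewrite ler_pdivlMr.
Qed.

End Hol.

(** * The Stein equation and one step of the Schur algorithm *)

Section Stein.
Local Open Scope sesquilinear_scope.

Context {C : numClosedFieldType}.

Definition stable n (Z : 'M[C]_n) := is_trig_mx Z /\ forall i, `|Z i i| < 1.

Definition stein n (Z A : 'M[C]_n) (e c : 'cV[C]_n) :=
  A - Z *m A *m Z ^t* = e *m e ^t* - c *m c ^t*.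

Definition nonneg_form n (A : 'M[C]_n) :=
  forall v : 'cV[C]_n, 0 <= (v ^t* *m A *m v) 0 0.

Lemma adjE m n (A : 'M[C]_(m, n)) i j : (A ^t*) i j = (A j i)^*.
Proof. by rewrite !mxE. Qed.

Lemma adjM m n p (A : 'M[C]_(m, n)) (B : 'M[C]_(n, p)) :
  (A *m B) ^t* = B ^t* *m A ^t*.
Proof. by rewrite trmx_mul map_mxM. Qed.

Lemma adjB m n (A B : 'M[C]_(m, n)) : (A - B) ^t* = A ^t* - B ^t*.
Proof. by rewrite linearB map_mxB. Qed.

Lemma adjZ m n a (A : 'M[C]_(m, n)) : (a *: A) ^t* = a^* *: A ^t*.
Proof. by rewrite linearZ map_mxZ. Qed.

Lemma adj0 m n : (0 : 'M[C]_(m, n)) ^t* = 0.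
Proof. by rewrite trmx0 map_mx0. Qed.

Lemma adj_col_mx m n p (A : 'M[C]_(m, p)) (B : 'M[C]_(n, p)) :
  (col_mx A B) ^t* = row_mx (A ^t*) (B ^t*).
Proof. by rewrite tr_col_mx map_row_mx. Qed.

Lemma adj_block_mx m1 m2 n1 n2 (A : 'M[C]_(m1, n1)) (B : 'M[C]_(m1, n2)) D (E : 'M[C]_(m2, n2)) :
  (block_mx A B D E) ^t* = block_mx (A ^t*) (D ^t*) (B ^t*) (E ^t*).
Proof. by rewrite tr_block_mx map_block_mx. Qed.

Lemma adj_scalar n a : (a%:M : 'M[C]_n) ^t* = (a^*)%:M.
Proof. by rewrite tr_scalar_mx map_scalar_mx. Qed.

Lemma stable_block n (Z : 'M[C]_(1 + n)) : stable Z ->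
  exists (a : C) z Z', [/\ Z = block_mx a%:M 0 z Z', `|a| < 1 & stable Z'].
Proof.
move=> [tZ dZ].
have Z0 : ursubmx Z = 0 by rewrite ursubmx_trig.
exists (Z (lshift n 0) (lshift n 0)), (dlsubmx Z), (drsubmx Z); split.
- rewrite -[LHS]submxK Z0; congr block_mx.
  by apply/matrixP => i j; rewrite !ord1 !mxE eqxx mulr1n; congr (Z _ _); apply: val_inj.
- exact: dZ.
- by split=> [|i]; [rewrite drsubmx_trig|rewrite !mxE].
Qed.

Lemma unit_sub_stable n (Z : 'M[C]_n) (a : C) : `|a| < 1 -> stable Z ->
  1%:M - a *: Z \in unitmx.
Proof.
move=> a1 [/is_trig_mxP tZ dZ]; rewrite unitmxE det_trig.
  rewrite unitfE; apply/prodf_neq0 => i _; rewrite !mxE eqxx subr_eq0.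
  apply: contraTneq (dZ i) => /(congr1 Num.norm); rewrite normr1 normrM => h.
  rewrite -real_leNgt// h.
  by rewrite ler_piMl// ltW.
apply/is_trig_mxP => i j ij; rewrite !mxE tZ// mulr0 subr0.
by case: eqVneq ij => // ->; rewrite ltnn.
Qed.

Lemma sub_scale_eq0 n m (Z : 'M[C]_n) (a : C) (x : 'M[C]_(n, m)) : `|a| < 1 -> stable Z ->
  x - a *: (Z *m x) = 0 -> x = 0.
Proof.
move=> a1 sZ h; have u := unit_sub_stable a1 sZ.
have : (1%:M - a *: Z) *m x = 0 by rewrite mulmxBl mul1mx -scalemxAl.
by move/(congr1 (mulmx (invmx (1%:M - a *: Z)))); rewrite mulKmx// mulmx0.
Qed.

Lemma norm1_neq0 (a b : C) : `|a| < 1 -> `|b| < 1 -> 1 - a * b != 0.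
Proof.
move=> a1 b1; rewrite subr_eq0; apply: contraTneq a1.
move=> /(congr1 Num.norm); rewrite normr1 normrM => h.
by rewrite -real_leNgt// h ler_piMr// ltW.
Qed.

(** The first column x of X satisfies x = conj(a) Z x, and the first row a similar
equation; as 1 - conj(a) Z has no zero on its diagonal, both vanish. *)
Lemma stein_zero_head n (a : C) (z : 'cV[C]_n) (Z : 'M[C]_n) (X : 'M[C]_(1 + n)) e c :
  `|a| < 1 -> stable Z ->
  stein (block_mx a%:M 0 z Z) X (col_mx 0 e) (col_mx 0 c) ->
  exists2 X', X = block_mx 0 0 0 X' & stein Z X' e c.
Proof.
move=> a1 sZ; rewrite /stein adj_block_mx !adj_col_mx !adj0 !mul_col_row !mul0mx !mulmx0.
rewrite -(submxK X); move: (ulsubmx X) (ursubmx X) (dlsubmx X) (drsubmx X).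
move=> X1 X2 X3 X4; rewrite adj_scalar !mulmx_block !mul0mx.
rewrite !mulmx0 !addr0 !mul_scalar_mx !mul_mx_scalar !opp_block_mx !add_block_mx !subr0.
move=> /eq_block_mx[h1 h2 h3 h4].
have a1' : `|a^*| < 1 by rewrite norm_conjC.
have X10 : X1 = 0.
  move: h1; rewrite scalerA -{1}[X1]scale1r -scalerBl => /eqP.
  by rewrite scaler_eq0 (negPf (norm1_neq0 a1' a1)) => /eqP.
have X30 : X3 = 0.
  apply: (sub_scale_eq0 a1' sZ).
  by move: h3; rewrite X10 mulmx0 add0r.
have X20 : X2 = 0.
  suff X2a : X2 ^t* = 0 by rewrite -[X2]trmxCK X2a adj0.
  apply: (sub_scale_eq0 a1' sZ); move: h2; rewrite X10 scaler0 mul0mx add0r => /(congr1 (fun M => M ^t*)).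
  by rewrite adj0 adjB adjM trmxCK adjZ -scalemxAr.
exists X4; first by rewrite X10 X20 X30.
by move: h4; rewrite X10 X20 X30 !mulmx0 !addr0 !mul0mx !add0r.
Qed.

Lemma stein_uniq n (Z X : 'M[C]_n) : stable Z -> X - Z *m X *m Z ^t* = 0 -> X = 0.
Proof.
elim: n => [|n IH] in Z X * => sZ hX; first exact: thinmx0.
have [a [z [Z' [ZE a1 sZ']]]] := @stable_block n Z sZ.
have [|X' -> hX'] := @stein_zero_head n a z Z' X 0 0 a1 sZ'.
  by rewrite /stein -ZE col_mx0 !mul0mx subrr.
rewrite (IH _ X' sZ') ?block_mx0//.
by move: hX'; rewrite /stein !mul0mx subrr.
Qed.

Lemma stein_adj n (Z A : 'M[C]_n) e c : stein Z A e c -> stein Z (A ^t*) e c.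
Proof.
move=> h; have := congr1 (fun M => M ^t*) h.
by rewrite /stein /= !adjB !adjM !trmxCK mulmxA.
Qed.

Lemma stein_herm n (Z A : 'M[C]_n) e c : stable Z -> stein Z A e c -> A ^t* = A.
Proof.
move=> sZ h; apply/eqP; rewrite -subr_eq0; apply/eqP; apply: (stein_uniq sZ).
have h' := stein_adj h; move: h h'; rewrite /stein => <- h'.
by rewrite mulmxBr mulmxBl opprD opprK addrACA h' addrACA subrr addNr addr0.
Qed.

Lemma mul_col_row_adj n (a b : 'cV[C]_n) i j : (a *m b ^t*) i j = a i 0 * (b j 0)^*.
Proof. by rewrite !mxE big_ord1 adjE. Qed.

Lemma form_block n (k : C) (y : 'cV[C]_(1 + n)) (A : 'M[C]_n) (t : 'M[C]_1) (v : 'cV[C]_n) :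
  ((col_mx t v) ^t* *m (k *: (y *m y ^t*) + block_mx 0 0 0 A) *m col_mx t v) 0 0 =
  k * `|((y ^t*) *m col_mx t v) 0 0| ^+ 2 + (v ^t* *m A *m v) 0 0.
Proof.
rewrite mulmxDr mulmxDl -scalemxAr -scalemxAl mxE [in LHS]mxE; congr (_ + _).
  congr (_ * _); rewrite mulmxA -(mulmxA _ (y ^t*)).
  rewrite -[_ ^t* *m y]trmxCK adjM trmxCK.
  by rewrite mxE big_ord1 adjE normCK mulrC.
rewrite adj_col_mx mul_row_block !mulmx0 !addr0 add0r mul_row_col.
by rewrite mul0mx add0r.
Qed.

Lemma nonneg_form_sub n (k : C) (y : 'cV[C]_(1 + n)) (A : 'M[C]_n) :
  0 < k -> nonneg_form A -> nonneg_form (k *: (y *m y ^t*) + block_mx 0 0 0 A).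
Proof.
move=> k0 hA v; rewrite -[v](@vsubmxK _ 1) form_block.
by rewrite addr_ge0// mulr_ge0// ?(ltW k0)// exprn_ge0.
Qed.

(** As the first entry of y is not zero, any v can be completed by a first entry
that makes the vector orthogonal to y. *)
Lemma nonneg_form_reduce n (k : C) (y : 'cV[C]_(1 + n)) (A : 'M[C]_n) :
  y 0 0 != 0 -> nonneg_form (k *: (y *m y ^t*) + block_mx 0 0 0 A) -> nonneg_form A.
Proof.
move=> y0 hA v; pose y2 := @dsubmx _ 1 n 1 y.
pose t : 'M[C]_1 := (- ((y2 ^t* *m v) 0 0) / (y 0 0)^*)%:M.
have := hA (col_mx t v); rewrite form_block.
suff -> : ((y ^t*) *m col_mx t v) 0 0 = 0 by rewrite normr0 expr0n mulr0 add0r.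
rewrite -[y](@vsubmxK _ 1) adj_col_mx mul_row_col mxE -/y2.
rewrite /t mul_mx_scalar !mxE.
have -> : (y (lshift n 0) 0) = y 0 0 by congr (y _ _); apply: val_inj.
by rewrite divfK ?addNr// conjC_eq0.
Qed.

(** With A3 the rest of the first column, the form at (t, A3) is affine in the
real number t with slope 2 |A3|^2; being nonnegative, it is constant. *)
Lemma nonneg_form_head0 n (A : 'M[C]_(1 + n)) : A ^t* = A -> nonneg_form A ->
  A 0 0 = 0 -> forall i, A i 0 = 0.
Proof.
move=> hA pA A0.
rewrite -(submxK A) in hA pA A0 *.
move: (ulsubmx A) (ursubmx A) (dlsubmx A) (drsubmx A) hA pA A0 => A1 A2 A3 A4.
rewrite adj_block_mx => /eq_block_mx[_ h3 h2 _] pA A0.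
have A10 : A1 = 0.
  apply/matrixP => i j; rewrite !ord1 [RHS]mxE -A0.
  have {2}-> : (0 : 'I_(1 + n)) = lshift n 0 by apply: val_inj.
  have {1}-> : (0 : 'I_(1 + n)) = lshift n 0 by apply: val_inj.
  by rewrite block_mxEul.
suff A30 : A3 = 0.
  move=> i; have -> : (0 : 'I_(1 + n)) = lshift n 0 by apply: val_inj.
  case: (split_ordP i) => j ->; rewrite ?block_mxEul ?block_mxEdl ?A10 ?A30 ?mxE//.
have form (t : C) : ((col_mx t%:M A3) ^t* *m block_mx A1 A2 A3 A4 *m col_mx t%:M A3) 0 0
   = (t + t^*) * (A3 ^t* *m A3) 0 0 + (A3 ^t* *m A4 *m A3) 0 0.
  rewrite adj_col_mx mul_row_block A10 mulmx0 add0r mul_row_col mulmxDl.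
  rewrite adj_scalar -h3 mul_mx_scalar mul_scalar_mx -scalemxAl.
  by rewrite addrA -scalerDl !mxE.
set s := (A3 ^t* *m A3) 0 0 in form; set b := (A3 ^t* *m A4 *m A3) 0 0 in form.
have s_ge0 : s = \sum_i `|A3 i 0| ^+ 2.
  rewrite /s mxE; apply: eq_bigr => i _.
  by rewrite adjE normCK mulrC.
have s0 : 0 <= s by rewrite s_ge0 sumr_ge0// => i _; rewrite exprn_ge0.
have b0 : 0 <= b by have := pA (col_mx 0%:M A3); rewrite form conjC0 addr0 mul0r add0r.
suff : s = 0.
  rewrite s_ge0 => /eqP; rewrite psumr_eq0; last by move=> i _; rewrite exprn_ge0.
  move=> /allP h; apply/matrixP => i j; rewrite ord1 [RHS]mxE; apply/eqP.
  by have := h i (mem_index_enum _); rewrite /= expf_eq0 normr_eq0.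
apply/eqP; apply/negPn/negP => sn0.
pose t := - ((b + 1) / (2 * s)).
have treal : t^* = t.
  apply: conj_Creal; rewrite rpredN rpred_div//; first by rewrite rpredD ?ger0_real.
  by rewrite rpredM ?ger0_real.
have := pA (col_mx t%:M A3); rewrite form treal.
have -> : (t + t) * s + b = -1 by rewrite /t; field.
by rewrite oppr_ge0 ler10.
Qed.

Lemma stein_sub_rank1 n (W A : 'M[C]_n) k (e c e1 c1 y : 'cV[C]_n) : stein W A e c ->
  (forall i j, e i 0 * (e j 0)^* - c i 0 * (c j 0)^* =
     k * (y i 0 * (y j 0)^* - (W *m y) i 0 * ((W *m y) j 0)^*) +
     (e1 i 0 * (e1 j 0)^* - c1 i 0 * (c1 j 0)^*)) ->
  stein W (A - k *: (y *m y ^t*)) e1 c1.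
Proof.
move=> hA h; rewrite /stein mulmxBr mulmxBl -scalemxAr -scalemxAl.
rewrite opprD opprK addrACA hA.
have -> : W *m (y *m y ^t*) *m W ^t* = (W *m y) *m (W *m y) ^t*.
  by rewrite adjM !mulmxA.
apply/matrixP => i j; have := h i j.
rewrite -!mul_col_row_adj.
move: (e *m e ^t*) (c *m c ^t*) (y *m y ^t*) (W *m y *m (W *m y) ^t*)
  (e1 *m e1 ^t*) (c1 *m c1 ^t*).
move=> M1 M2 M3 M4 M5 M6 hM.
by move: hM; rewrite !mxE => ->; ring.
Qed.

(** The vectors (e - conj(g) c) / q and (c - g e) / q, with q^2 = 1 - |g|^2, give
the same right-hand side of the Stein equation as e and c, and the second one
has first entry 0.  Write the first one as (1 - conj(a) W) y.  Replacing it by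
(W - a) y, which also has first entry 0, changes the solution by
(1 - |a|^2) y adj(y); the rest is covered by [stein_zero_head]. *)
Lemma schur_step n (a g : C) (W : 'M[C]_(1 + n)) z Z (A : 'M[C]_(1 + n)) (e c : 'cV[C]_(1 + n)) :
  stable W -> W = block_mx a%:M 0 z Z -> `|a| < 1 -> stable Z -> `|g| < 1 ->
  stein W A e c -> e 0 0 != 0 -> c 0 0 = g * e 0 0 ->
  exists (q : C) (y : 'cV[C]_(1 + n)) (A' : 'M[C]_n) (e' c' : 'cV[C]_n),
  [/\ 0 < q /\ q ^+ 2 = 1 - g * g^*,
     A = (1 - a * a^*) *: (y *m y ^t*) + block_mx 0 0 0 A', stein Z A' e' c' & y 0 0 != 0] /\
  forall i, [/\ e i 0 - g^* * c i 0 = q * (y i 0 - a^* * (W *m y) i 0),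
     c i 0 - g * e i 0 = q * (col_mx 0 c' : 'cV_(1 + n)) i 0 &
     (W *m y) i 0 - a * y i 0 = (col_mx 0 e' : 'cV_(1 + n)) i 0].
Proof.
move=> sW WE a1 sZ g1 hA e0 c0.
have q2 : 0 < 1 - g * g^* by rewrite -normCK subr_gt0 expr_lt1.
pose q := sqrtC (1 - g * g^*).
have q0 : 0 < q by rewrite sqrtC_gt0.
have qq : q ^+ 2 = 1 - g * g^* by rewrite sqrtCK.
have qn0 : q != 0 by rewrite gt_eqF.
have a1' : `|a^*| < 1 by rewrite norm_conjC.
pose y := q^-1 *: (invmx (1%:M - a^* *: W) *m (e - g^* *: c)).
pose c' := q^-1 *: (@dsubmx _ 1 n 1 (c - g *: e)).
have hy : y - a^* *: (W *m y) = q^-1 *: (e - g^* *: c).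
  rewrite -{1}[y]mul1mx scalemxAl -mulmxBl /y -scalemxAr mulKVmx//.
  exact: unit_sub_stable.
clearbody y; pose e' := @dsubmx _ 1 n 1 (W *m y - a *: y).
have H1 i : e i 0 - g^* * c i 0 = q * (y i 0 - a^* * (W *m y) i 0).
  have := hy; move: (W *m y) => w /matrixP /(_ i 0); rewrite !mxE => ->.
  by rewrite mulVKf.
have H2 i : c i 0 - g * e i 0 = q * (col_mx 0 c' : 'cV_(1 + n)) i 0.
  case: (split_ordP i) => j ->.
    rewrite col_mxEu mxE mulr0 ord1 (_ : lshift n 0 = 0) ?c0 ?subrr//.
    exact: val_inj.
  by rewrite col_mxEd !mxE mulVKf.
have Wy0 : (W *m y) 0 0 = a * y 0 0.
  rewrite WE -[y](@vsubmxK _ 1) mul_block_col mul0mx addr0 mul_scalar_mx.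
  have -> : (0 : 'I_(1 + n)) = lshift n 0 by apply: val_inj.
  by rewrite !col_mxEu mxE.
have H3 i : (W *m y) i 0 - a * y i 0 = (col_mx 0 e' : 'cV_(1 + n)) i 0.
  case: (split_ordP i) => j ->.
    rewrite col_mxEu [RHS]mxE ord1 (_ : lshift n 0 = 0) ?Wy0 ?subrr//.
    exact: val_inj.
  by rewrite col_mxEd /e'; move: (W *m y) => w; rewrite !mxE.
have y0 : y 0 0 != 0.
  apply: contra_neq e0 => y0; have := H1 0; rewrite c0 Wy0 y0 !mulr0 subrr mulr0.
  move/eqP; rewrite mulrA -{1}[e 0 0]mul1r -mulrBl mulrC mulf_eq0 [g^* * _]mulrC (gt_eqF q2) orbF.
  by move/eqP.
have hX : stein W (A - (1 - a * a^*) *: (y *m y ^t*)) (col_mx 0 e') (col_mx 0 c').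
  apply: (stein_sub_rank1 hA) => i j; rewrite -!H3.
  apply: (mulfI (_ : 1 - g * g^* != 0)); first by rewrite gt_eqF.
  have -> : (1 - g * g^*) * (e i 0 * (e j 0)^* - c i 0 * (c j 0)^*) =
    (e i 0 - g^* * c i 0) * (e j 0 - g^* * c j 0)^* -
    (c i 0 - g * e i 0) * (c j 0 - g * e j 0)^*.
    by rewrite !rmorphB !rmorphM /= conjCK; ring.
  rewrite !H1 !H2 -qq.
  rewrite !rmorphM !rmorphB !rmorphM /= !conjCK (conj_Creal (gtr0_real q0)).
  ring.
have [A' A'E hA'] := stein_zero_head a1 sZ (eq_ind _ (fun W => stein W _ _ _) hX _ WE).
exists q, y, A', e', c'; split; first by split => //; rewrite -A'E addrC subrK.
by move=> i; split.
Qed.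

(** A linear endomorphism of the space of matrices that is injective by
[stein_uniq] is surjective. *)
Lemma stein_ex n (Z B : 'M[C]_n) : stable Z -> exists X, X - Z *m X *m Z ^t* = B.
Proof.
move=> sZ; pose M : 'M[C]_(n * n) := 1%:M - lin_mx (mulmxr (Z ^t*) \o mulmx Z).
have vM (u : 'rV_(n * n)) : vec_mx (u *m M) = vec_mx u - Z *m vec_mx u *m Z ^t*.
  by rewrite mulmxBr mulmx1 linearB /= mul_rV_lin /= mxvecK.
have uM : M \in unitmx.
  rewrite -row_free_unit; apply: inj_row_free => v vM0.
  have := vM v; rewrite vM0 linear0 => /esym/(stein_uniq sZ) v0.
  by rewrite -[v]vec_mxK v0 linear0.
by exists (vec_mx (mxvec B *m invmx M)); rewrite -vM mulmxKV// mxvecK.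
Qed.

End Stein.

(** * Interpolation through the resolvent *)

Section Resolvent.
Local Open Scope sesquilinear_scope.

Context {R : realType}.
Local Notation C := R[i].
Implicit Types (s : seq C) (phi : C -> C).

(** The interpolation condition: (z - Z)^-1 (phi z *: e - c) is bounded on the unit
disk.  A finite set s is left out of the condition, since the functions that
the Schur algorithm produces from phi may have singularities there. *)
Definition resolves n (Z : 'M[C]_n) (e c : 'cV[C]_n) phi s :=
  exists (h : C -> 'cV[C]_n) (K : C), forall z, `|z| < 1 -> z \notin s ->
    (forall i, z * h z i 0 - (Z *m h z) i 0 = phi z * e i 0 - c i 0) /\
    (forall i, `|h z i 0| <= K).

Lemma norm_lt1E (z : C) : (`|z| < 1) = (normc z < 1).
Proof. by rewrite normcR -ltcR. Qed.

Lemma leC_real (k : C) (x : R) : (x%:C)%C <= k -> exists2 y : R, k = (y%:C)%C & x <= y.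
Proof.
case: k => u v; rewrite lecE /= => /andP[/eqP -> ?]; by exists u.
Qed.

(** [schwarz_exceptional] for the norm with values in the field C itself. *)
Lemma schwarzC (a K : C) (f : C -> C) s : `|a| < 1 ->
  (forall z, `|z| < 1 -> z \notin s -> hol f z) ->
  (forall z, `|z| < 1 -> z \notin s -> `|f z| <= K) ->
  (forall z, `|z| < 1 -> z \notin s -> `|f z| * `|z - a| <= `|1 - a^* * z|) ->
  forall z, `|z| < 1 -> z \notin s -> `|f z| <= 1.
Proof.
move=> a1 hf fK fa z z1 zs.
have [k KE _] := leC_real (fK z z1 zs).
rewrite normcR (lecR _ 1); apply: (@schwarz_exceptional _ a f s k) zs.
- by rewrite -norm_lt1E.
- by move=> w w1 ws; apply: hf => //; rewrite norm_lt1E.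
- by move=> w w1 ws; rewrite -lecR -normcR -KE; apply: fK => //; rewrite norm_lt1E.
- move=> w w1 ws; rewrite -lecR rmorphM /=; apply: fa => //; by rewrite norm_lt1E.
- by rewrite -norm_lt1E.
Qed.

Lemma avoid_finite (a : C) s (d : R) : normc a < 1 -> 0 < d ->
  exists z, [/\ `|z| < 1, z \notin s & normc (z - a) <= d].
Proof.
move=> a1 d0.
have [r r0 hr] : exists2 r : R, 0 < r & forall z, 0 < normc (z - a) < r -> z \notin s.
  elim: s => [|p s [r r0 IH]]; first by exists 1.
  have [->|pa] := eqVneq p a.
    exists r => // z zr; rewrite inE negb_or IH// andbT.
    by apply: contraTneq zr => ->; rewrite subrr normc0 ltxx.
  have pa0 : 0 < normc (p - a).
    rewrite lt_neqAle normc_ge0 andbT eq_sym; apply: contraNneq pa => /eq0_normc/eqP.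
    by rewrite subr_eq0.
  exists (Num.min r (normc (p - a))); first by rewrite lt_min r0.
  move=> z; rewrite lt_min => /and3P[z0 zr zp]; rewrite inE negb_or IH ?z0// andbT.
  by apply: contraTneq zp => ->; rewrite ltxx.
pose t := Num.min (Num.min r d) (1 - normc a) / 2.
have t0 : 0 < t by rewrite divr_gt0// !lt_min r0 d0 subr_gt0.
have tr : t < r /\ t < d /\ t < 1 - normc a.
  have m0 : 0 < Num.min (Num.min r d) (1 - normc a) by rewrite !lt_min r0 d0 subr_gt0.
  have : Num.min (Num.min r d) (1 - normc a) <= r by rewrite !ge_min lexx.
  have : Num.min (Num.min r d) (1 - normc a) <= d by rewrite !ge_min lexx orbT.
  have : Num.min (Num.min r d) (1 - normc a) <= 1 - normc a by rewrite ge_min lexx orbT.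
  by rewrite /t; lra.
have tn : normc (t%:C)%C = t by rewrite normc_pos.
case: tr => [tr [td t1]].
exists (a + (t%:C)%C); have E : a + (t%:C)%C - a = (t%:C)%C by rewrite addrC addKr.
split; last by rewrite E tn ltW.
- by rewrite norm_lt1E (le_lt_trans (le_normcD _ _))// tn; lra.
- by apply: hr; rewrite E tn t0.
Qed.

Lemma mul_block_head n (a : C) z (Z : 'M[C]_n) (h : 'cV[C]_(1 + n)) :
  ((block_mx a%:M 0 z Z : 'M[C]_(1 + n)) *m h) 0 0 = a * h 0 0.
Proof.
rewrite -[h](@vsubmxK _ 1) mul_block_col mul0mx addr0 mul_scalar_mx.
have -> : (0 : 'I_(1 + n)) = lshift n 0 by apply: val_inj.
by rewrite !col_mxEu mxE.
Qed.

(** The first equation reads (z - a) h_0 = 0, so h_0 vanishes as soon as z is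
different from a, whence the new exceptional point. *)
Lemma resolves_tail n (a : C) z (Z : 'M[C]_n) e c phi s :
  resolves (block_mx a%:M 0 z Z : 'M[C]_(1 + n)) (col_mx 0 e) (col_mx 0 c) phi s ->
  resolves Z e c phi (a :: s).
Proof.
move=> [h [K hK]]; exists (fun z => dsubmx (h z)), K => w w1.
rewrite inE negb_or => /andP[wa ws]; have [hE hb] := hK w w1 ws.
have h0 : h w 0 0 = 0.
  have := hE 0; rewrite mul_block_head.
  have -> : (0 : 'I_(1 + n)) = lshift n 0 by apply: val_inj.
  rewrite !col_mxEu !mxE mulr0 subrr -mulrBl => /eqP; rewrite mulf_eq0 subr_eq0 (negPf wa).
  by move=> /eqP.
split=> i; last by rewrite mxE hb.
have := hE (rshift 1 i); rewrite !col_mxEd => <-; congr (_ - _); first by rewrite mxE.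
rewrite -[h w in RHS](@vsubmxK _ 1) mul_block_col col_mxEd [RHS]mxE.
suff -> : usubmx (h w) = 0 by rewrite mulmx0 [X in X + _]mxE add0r.
apply/matrixP => j k; rewrite !ord1 !mxE -h0; congr (h w _ _); exact: val_inj.
Qed.

Lemma resolves_cons n (a : C) z (Z : 'M[C]_n) e c phi s :
  resolves Z e c phi s ->
  resolves (block_mx a%:M 0 z Z : 'M[C]_(1 + n)) (col_mx 0 e) (col_mx 0 c) phi s.
Proof.
move=> [h [K hK]]; exists (fun z => col_mx 0 (h z)), `|K| => w w1 ws.
have [hE hb] := hK w w1 ws; split=> i; case: (split_ordP i) => j ->.
- by rewrite mul_block_col !col_mxEu mulmx0 mul0mx addr0 !mxE !mulr0 !subr0.
- by rewrite mul_block_col !col_mxEd mulmx0 add0r.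
- by rewrite col_mxEu mxE normr0.
- by rewrite col_mxEd (ger0_norm (le_trans (normr_ge0 _) (hb j))).
Qed.

Lemma moebius_identity (g w : C) :
  `|1 - g^* * w| ^+ 2 - `|w - g| ^+ 2 = (1 - `|g| ^+ 2) * (1 - `|w| ^+ 2).
Proof. by rewrite !normCK !rmorphB !rmorphM /= conjCK rmorph1; ring. Qed.

Lemma moebius_le (g w : C) : `|g| <= 1 -> `|w| <= 1 -> `|w - g| <= `|1 - g^* * w|.
Proof.
move=> g1 w1; rewrite -ler_sqr ?nnegrE// -subr_ge0 moebius_identity.
by rewrite mulr_ge0// subr_ge0 expr_le1.
Qed.

Lemma moebius_lt (g w : C) : `|g| < 1 -> `|w| < 1 -> `|w - g| < `|1 - g^* * w|.
Proof.
move=> g1 w1; rewrite -ltr_sqr ?nnegrE// -subr_gt0 moebius_identity.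
by rewrite mulr_gt0// subr_gt0 expr_lt1.
Qed.

Lemma moebius_den (g w : C) : `|g| < 1 -> `|w| <= 1 -> 1 - `|g| <= `|1 - g^* * w|.
Proof.
move=> g1 w1; have := lerB_dist 1 (g^* * w); rewrite normr1 normrM norm_conjC.
by apply: le_trans; rewrite lerD2l lerN2 ler_piMr.
Qed.

Lemma moebius_den_neq0 (g w : C) : `|g| < 1 -> `|w| <= 1 -> 1 - g^* * w != 0.
Proof.
move=> g1 w1; rewrite -normr_gt0; apply: lt_le_trans (moebius_den g1 w1).
by rewrite subr_gt0.
Qed.

End Resolvent.

(** * The Schur algorithm on functions *)

Section Induction.
Local Open Scope sesquilinear_scope.

Context {R : realType}.
Local Notation C := R[i].
Implicit Types (s : seq C) (phi : C -> C).

Lemma hol_subc (f : C -> C) g z : hol f z -> hol (fun z => f z - g) z.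
Proof. by move=> hf; exact: (@holD _ f (fun=> - g) z hf (@hol_cst _ (- g) z)). Qed.

Lemma hol_addc (f : C -> C) g z : hol f z -> hol (fun z => f z + g) z.
Proof. by move=> hf; exact: (@holD _ f (fun=> g) z hf (@hol_cst _ g z)). Qed.

Lemma hol_csub (f : C -> C) k z : hol f z -> hol (fun z => 1 - k * f z) z.
Proof.
move=> hf; have h1 := @holM _ (fun=> k) f z (@hol_cst _ k z) hf.
exact: (@holD _ (fun=> 1) (fun z => - (k * f z)) z (@hol_cst _ 1 z) (@holN _ _ z h1)).
Qed.

Lemma hol_cadd (f : C -> C) k z : hol f z -> hol (fun z => 1 + k * f z) z.
Proof.
move=> hf; have h1 := @holM _ (fun=> k) f z (@hol_cst _ k z) hf.
exact: (@holD _ (fun=> 1) (fun z => k * f z) z (@hol_cst _ 1 z) h1).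
Qed.

Lemma hol_div (f g : C -> C) z : hol f z -> hol g z -> g z != 0 ->
  hol (fun z => f z / g z) z.
Proof. by move=> hf hg g0; exact: (@holM _ f (fun z => (g z)^-1) z hf (@holV _ g z g0 hg)). Qed.

Lemma blaschke_num_le2 (a z : C) : `|a| < 1 -> `|z| < 1 -> `|1 - a^* * z| <= 2.
Proof.
move=> a1 z1; rewrite (le_trans (ler_normB _ _))// normr1 normrM norm_conjC.
by rewrite -[leRHS]/(1 + 1) lerD2l mulr_ile1// ltW.
Qed.

(** The witness for psi is q / (1 - conj(g) phi) h - psi (1 - |a|^2) / (1 - conj(a) z) y.
The function psi is a multiple of the first entry of h, which makes it bounded;
then Schwarz's lemma makes it bounded by 1. *)
Lemma schur_resolves n (a g q : C) W z Z (e c y e1 c1 : 'cV[C]_(1 + n)) phi s :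
  W = block_mx a%:M 0 z Z -> `|a| < 1 -> `|g| < 1 -> 0 < q -> q ^+ 2 = 1 - g * g^* ->
  e 0 0 != 0 -> c 0 0 = g * e 0 0 ->
  (forall i, [/\ e i 0 - g^* * c i 0 = q * (y i 0 - a^* * (W *m y) i 0),
     c i 0 - g * e i 0 = q * c1 i 0 & (W *m y) i 0 - a * y i 0 = e1 i 0]) ->
  (forall z, `|z| < 1 -> z \notin s -> `|phi z| <= 1) ->
  (forall z, `|z| < 1 -> z \notin s -> hol phi z) ->
  resolves W e c phi s ->
  exists psi : C -> C, [/\ forall z, `|z| < 1 -> z \notin a :: s -> `|psi z| <= 1,
    forall z, `|z| < 1 -> z \notin a :: s -> hol psi z &
    resolves W e1 c1 psi (a :: s)].
Proof.
move=> WE a1 g1 q0 qq e0 c0 H phi1 hphi [h [K hK]].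
pose psi w := (phi w - g) / (1 - g^* * phi w) * ((1 - a^* * w) / (w - a)).
have nots w : w \notin a :: s -> w - a != 0 /\ w \notin s.
  by rewrite inE negb_or subr_eq0 => /andP[].
have d0 w : `|w| < 1 -> w \notin s -> 1 - g^* * phi w != 0.
  by move=> w1 ws; apply: moebius_den_neq0 => //; exact: phi1.
have m0 w : `|w| < 1 -> 1 - a^* * w != 0 by move=> w1; apply: moebius_den_neq0 => //; exact: ltW.
have hpsi w : `|w| < 1 -> w \notin a :: s -> hol psi w.
  move=> w1 /nots[wa ws]; have hp := hphi w w1 ws.
  have h1 := hol_div (@hol_subc phi g w hp) (@hol_csub phi g^* w hp) (d0 w w1 ws).
  have h2 := hol_div (@hol_csub id a^* w (@hol_id _ w)) (@hol_subc id a w (@hol_id _ w)) wa.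
  exact: (@holM _ _ _ w h1 h2).
(* the first equation is (w - a) h_0 = (phi w - g) e_0 *)
have bpsi w : `|w| < 1 -> w \notin a :: s ->
    `|psi w| <= K / `|e 0 0| * (2 / (1 - `|g|)).
  move=> w1 /nots[wa ws]; have [hE hb] := hK w w1 ws.
  have := hE 0; rewrite WE mul_block_head c0 -mulrBl -mulrBl => h0.
  have -> : psi w = h w 0 0 / e 0 0 * ((1 - a^* * w) / (1 - g^* * phi w)).
    have -> : h w 0 0 = (phi w - g) * e 0 0 / (w - a) by rewrite -h0 mulrAC mulfV ?mul1r.
    by rewrite /psi; field; rewrite wa e0 d0.
  rewrite !normrM !normfV ler_pM ?mulr_ge0 ?invr_ge0//.
    by rewrite ler_pM2r ?hb// invr_gt0 normr_gt0.
  rewrite ler_pM ?invr_ge0 ?blaschke_num_le2//.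
  rewrite lef_pV2 ?posrE ?subr_gt0 ?normr_gt0 ?d0//.
  by apply: moebius_den => //; exact: phi1.
have psi1 : forall w, `|w| < 1 -> w \notin a :: s -> `|psi w| <= 1.
  apply: (schwarzC a1 hpsi bpsi) => w w1 /nots[wa ws].
  rewrite -normrM /psi mulrA mulfVK// normrM ler_piMl//.
  rewrite normrM normfV ler_pdivrMr ?normr_gt0 ?d0// mul1r.
  by apply: moebius_le; [exact: ltW|exact: phi1].
exists psi; split => //.
exists (fun w => (q / (1 - g^* * phi w)) *: h w -
    (psi w * (1 - a * a^*) / (1 - a^* * w)) *: y).
pose My := \sum_i `|y i 0|.
exists (q / (1 - `|g|) * K + (1 / (1 - `|a|)) * My) => w w1 was.
have [wa ws] := nots w was; have [hE hb] := hK w w1 ws.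
have dn0 := d0 w w1 ws; have mn0 := m0 w w1.
split=> i.
  rewrite mulmxBr -!scalemxAr.
  have [] := H i; have := hE i.
  move: (W *m h w) (W *m y) => Wh Wy; rewrite !mxE.
  move: (h w i 0) (Wh i 0) (Wy i 0) (y i 0) (e i 0) (c i 0) (e1 i 0) (c1 i 0).
  move=> hi Whi wi yi ei ci e1i c1i P1 P2 P3 P4.
  have q00 : q != 0 by rewrite gt_eqF.
  have eE : q * ei = yi - a^* * wi + g^* * c1i.
    apply: (mulfI q00); rewrite mulrA -expr2 qq mulrDr mulrCA -P2 -P3; ring.
  have cE : ci = g * ei + q * c1i by rewrite -P3; ring.
  have -> : w * (q / (1 - g^* * phi w) * hi - psi w * (1 - a * a^*) / (1 - a^* * w) * yi) -
    (q / (1 - g^* * phi w) * Whi - psi w * (1 - a * a^*) / (1 - a^* * w) * wi) =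
    ((phi w - g) * (q * ei) - q ^+ 2 * c1i) / (1 - g^* * phi w) -
    psi w * (1 - a * a^*) / (1 - a^* * w) * (w * yi - wi).
    transitivity (q / (1 - g^* * phi w) * (w * hi - Whi) -
      psi w * (1 - a * a^*) / (1 - a^* * w) * (w * yi - wi)); first by ring.
    by rewrite P1 cE; congr (_ - _); field.
  rewrite eE qq -P4 /psi; field.
  by rewrite dn0 mn0 wa.
move: (h w) hb => hw hb; rewrite !mxE (le_trans (ler_normB _ _))// lerD// normrM.
  rewrite ler_pM// normrM normfV (gtr0_norm q0) ler_pM2l// lef_pV2 ?posrE ?subr_gt0 ?normr_gt0//.
  by apply: moebius_den => //; exact: phi1.
rewrite ler_pM//; last first.
  by rewrite /My (bigD1 i)//= lerDl sumr_ge0.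
rewrite normrM normfV ler_pM ?invr_ge0//; last first.
  rewrite lef_pV2 ?posrE ?subr_gt0 ?normr_gt0//.
  by apply: moebius_den => //; exact: ltW.
rewrite normrM mulr_ile1 ?psi1//.
have a2 : 0 <= 1 - `|a| ^+ 2 by rewrite subr_ge0 expr_le1// ltW.
by rewrite -normCK (ger0_norm a2) gerBl exprn_ge0.
Qed.

End Induction.

(** * Positivity is equivalent to interpolation *)

Section Main.
Local Open Scope sesquilinear_scope.

Context {R : realType}.
Local Notation C := R[i].
Implicit Types (s : seq C) (phi : C -> C).

Definition schur_on s phi :=
  (forall z, `|z| < 1 -> z \notin s -> hol phi z) /\
  (forall z, `|z| < 1 -> z \notin s -> `|phi z| <= 1).

Lemma form_block0 n (A : 'M[C]_n) (t : 'M[C]_1) (v : 'cV[C]_n) :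
  ((col_mx t v) ^t* *m (block_mx 0 0 0 A) *m col_mx t v) 0 0 = (v ^t* *m A *m v) 0 0.
Proof.
by have := form_block 0 0 A t v; rewrite mul0r add0r scale0r add0r.
Qed.

Lemma nonneg_block0 n (A : 'M[C]_n) :
  nonneg_form (block_mx 0 0 0 A : 'M[C]_(1 + n)) <-> nonneg_form A.
Proof.
split=> h v; first by have := h (col_mx 0 v); rewrite form_block0.
by rewrite -[v](@vsubmxK _ 1) form_block0.
Qed.

Lemma col_mx_head0 n (u : 'cV[C]_(1 + n)) : u 0 0 = 0 -> u = col_mx 0 (dsubmx u).
Proof.
move=> u0; rewrite -[LHS](@vsubmxK _ 1); congr col_mx; apply/matrixP => i j.
by rewrite !ord1 !mxE -u0; congr (u _ _); apply: val_inj.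
Qed.

Lemma eq_scale_head0 n (u : C) (e c : 'cV[C]_(1 + n)) : e 0 0 = 0 -> c 0 0 = 0 ->
  dsubmx c = u *: dsubmx e -> c = u *: e.
Proof.
move=> e0 c0 h; rewrite (col_mx_head0 c0) h [in RHS](col_mx_head0 e0).
by rewrite scale_col_mx scaler0.
Qed.

(** Let z tend to a in the first equation (z - a) h_0 = phi e_0 - c_0, where h_0 is
bounded. *)
Lemma head_bound n (a : C) (W : 'M[C]_(1 + n)) z Z e c phi s (rho : C) : `|a| < 1 ->
  W = block_mx a%:M 0 z Z ->
  (forall z, `|z| < 1 -> z \notin s -> `|phi z| <= rho) ->
  resolves W e c phi s -> `|c 0 0| <= rho * `|e 0 0|.
Proof.
move=> a1 WE hphi [h [K hK]].
apply/ler_addgt0Pr => d /real_gt0[d' d'0 ->].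
have a1' : normc a < 1 by rewrite -norm_lt1E.
have [z0 [z01 z0s _]] := avoid_finite s a1' ltr01.
have [k KE k0] : exists2 k : R, K = (k%:C)%C & 0 <= k.
  by apply: leC_real; exact: (le_trans (normr_ge0 (h z0 0 0)) ((hK z0 z01 z0s).2 0)).
have [|w [w1 ws wa]] := @avoid_finite _ a s (d' / (k + 1)) a1'.
  by rewrite divr_gt0// ltr_wpDl.
have [hE hb] := hK w w1 ws.
have := hE 0; rewrite WE mul_block_head -mulrBl => h0.
have -> : c 0 0 = phi w * e 0 0 - (w - a) * h w 0 0 by rewrite h0; ring.
rewrite (le_trans (ler_normB _ _))// !normrM lerD// ?ler_wpM2r ?hphi//.
apply: (@le_trans _ _ (`|w - a| * K)); first by rewrite ler_wpM2l.
rewrite KE normcR -rmorphM lecR.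
rewrite ler_pdivlMr ?ltr_wpDl// in wa.
by have := normc_ge0 (w - a); lra.
Qed.

Lemma nonneg_limit (D y : C) : D \is Num.real -> y \is Num.real ->
  (forall t, 0 < t -> t < 1 -> 0 <= D + t * y) -> 0 <= D.
Proof.
move=> Dr yr h; rewrite real_leNgt ?real0//; apply/negP => D0.
have nD : 0 < - D by rewrite oppr_gt0.
have m0 : 0 < `|y| - D by rewrite ltr_wpDl.
pose t := - D / (2 * (`|y| - D)).
have t0 : 0 < t by rewrite divr_gt0// mulr_gt0.
have t1 : t < 1.
  rewrite ltr_pdivrMr ?mulr_gt0// mul1r mulrDr.
  by rewrite ltr_wpDl ?mulr_ge0// mulr_natl mulr2n ltrDl.
have H : D + t * y <= D / 2.
  have tE : t * (`|y| - D) = - D / 2 by rewrite /t; field; rewrite gt_eqF.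
  have -> : D / 2 = D + (t * (`|y| - D)) by rewrite tE; field.
  rewrite lerD2l ler_pM2l// (le_trans (real_ler_norm yr))//.
  by rewrite lerDl ltW.
have := le_trans (h t t0 t1) H.
by rewrite pmulr_lge0 ?invr_gt0// => /le_lt_trans/(_ D0); rewrite ltxx.
Qed.

Lemma stein_form_real n (A : 'M[C]_n) (v : 'cV[C]_n) : A ^t* = A -> (v ^t* *m A *m v) 0 0 \is Num.real.
Proof.
move=> hA; apply/CrealP; rewrite -[LHS]adjE.
by rewrite !adjM trmxCK hA mulmxA.
Qed.

(** Induction on the size.  The Schur step requires |g| < 1, so the claim is proved
first for functions bounded by some rho < 1.  The general case follows by
scaling: if Ge and Gc solve the Stein equations with right-hand sides e adj(e)
and c adj(c), then A = Ge - Gc, while Ge - rho^2 Gc belongs to rho phi. *)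
Lemma nonneg_of_resolves n : forall (Z A : 'M[C]_n) e c phi s,
  stable Z -> stein Z A e c -> schur_on s phi -> resolves Z e c phi s ->
  nonneg_form A.
Proof.
elim: n => [|n IH] Z A e c phi s sZ hA [hphi phi1] hr.
  by move=> v; rewrite mxE big_ord0.
have strict (B : 'M[C]_(1 + n)) (d : 'cV[C]_(1 + n)) (f : C -> C) (rho : C) : rho < 1 ->
  stein Z B e d -> (forall z, `|z| < 1 -> z \notin s -> hol f z) ->
  (forall z, `|z| < 1 -> z \notin s -> `|f z| <= rho) ->
  resolves Z e d f s -> nonneg_form B.
  move=> rho1 hB hf frho hrf.
  have [a [z [Z' [ZE a1 sZ']]]] := @stable_block _ n Z sZ.
  have f1 w : `|w| < 1 -> w \notin s -> `|f w| <= 1.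
    by move=> w1 ws; rewrite (le_trans (frho w w1 ws))// ltW.
  have ed := head_bound a1 ZE frho hrf.
  have [e0|e0] := eqVneq (e 0 0) 0.
    have d0 : d 0 0 = 0.
      by move: ed; rewrite e0 normr0 mulr0 normr_le0 => /eqP.
    move: hB hrf; rewrite ZE (col_mx_head0 e0) (col_mx_head0 d0) => hB hrf.
    have [B' -> hB'] := stein_zero_head a1 sZ' hB.
    apply/nonneg_block0; apply: IH hB' _ (resolves_tail hrf) => //; split=> w w1.
      by rewrite inE negb_or => /andP[_]; exact: hf.
    by rewrite inE negb_or => /andP[_]; exact: f1.
  pose g := d 0 0 / e 0 0.
  have dE : d 0 0 = g * e 0 0 by rewrite divfK.
  have g1 : `|g| < 1.
    by rewrite normrM normfV (le_lt_trans _ rho1)// ler_pdivrMr// normr_gt0.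
  have [q [y [B' [e' [c' [[[q0 qq] BE hB' _] H]]]]]] :=
    schur_step sZ ZE a1 sZ' g1 hB e0 dE.
  have [psi [psi1 hpsi rpsi]] := schur_resolves ZE a1 g1 q0 qq e0 dE H f1 hf hrf.
  rewrite BE; apply: nonneg_form_sub; first by rewrite -normCK subr_gt0 expr_lt1.
  apply: (IH Z' B' e' c' psi (a :: a :: s)) => //; last first.
    by move: rpsi; rewrite ZE; exact: resolves_tail.
  split=> w w1; rewrite inE negb_or => /andP[_ ws]; first exact: hpsi.
  exact: psi1.
have [Ge hGe] := stein_ex (e *m e ^t*) sZ.
have [Gc hGc] := stein_ex (c *m c ^t*) sZ.
have AE : A = Ge - Gc.
  apply/eqP; rewrite -subr_eq0; apply/eqP/(stein_uniq sZ).
  rewrite !mulmxBr !mulmxBl -[X in _ = X](subrr (A - Z *m A *m Z ^t*)).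
  rewrite {2}hA -hGe -hGc.
  move: (Z *m A *m _) (Z *m Ge *m _) (Z *m Gc *m _) => M1 M2 M3.
  by apply/matrixP => i j; rewrite !mxE; ring.
have herm (M : 'M[C]_n.+1) (d : 'cV[C]_n.+1) : M - Z *m M *m Z ^t* = d *m d ^t* -> M ^t* = M.
  by move=> hM; apply: (@stein_herm _ _ Z M d 0 sZ); rewrite /stein mul0mx subr0.
move=> v; rewrite AE mulmxBr mulmxBl mxE [X in _ + X]mxE.
have xr := stein_form_real v (herm _ _ hGe).
have yr := stein_form_real v (herm _ _ hGc).
apply: (nonneg_limit _ yr); first by rewrite rpredB.
move=> t t0 t1; pose rho := sqrtC (1 - t).
have rho0 : 0 <= rho by rewrite sqrtC_ge0 subr_ge0 ltW.
have rho2 : rho * rho = 1 - t by rewrite -expr2 sqrtCK.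
have rho1 : rho < 1 by rewrite -sqrtC1 ltr_sqrtC ?nnegrE ?subr_ge0 ?(ltW t1)// gtrBl.
have hB : stein Z (Ge - (1 - t) *: Gc) e (rho *: c).
  rewrite /stein adjZ (geC0_conj rho0) -scalemxAl -scalemxAr scalerA rho2.
  rewrite -hGe -hGc mulmxBr mulmxBl -scalemxAr -scalemxAl.
  move: (Z *m Ge *m _) (Z *m Gc *m _) => M2 M3.
  by apply/matrixP => i j; rewrite !mxE; ring.
have hf w : `|w| < 1 -> w \notin s -> hol (fun z => rho * phi z) w.
  by move=> w1 ws; exact: (@holM _ (fun=> rho) phi w (@hol_cst _ rho w) (hphi w w1 ws)).
have frho w : `|w| < 1 -> w \notin s -> `|rho * phi w| <= rho.
  by move=> w1 ws; rewrite normrM (ger0_norm rho0) ler_piMr// phi1.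
have hrf : resolves Z e (rho *: c) (fun z => rho * phi z) s.
  have [h [K hK]] := hr; exists (fun z => rho *: h z), K => w w1 ws.
  have [hE hb] := hK w w1 ws; split=> i; last first.
    rewrite mxE normrM (ger0_norm rho0) (le_trans _ (hb i))//.
    by rewrite ler_piMl// ltW.
  have := hE i; rewrite -scalemxAr; move: (Z *m h w) => M hEi.
  by rewrite !mxE -mulrA -mulrBr -hEi; ring.
have := strict _ _ _ _ rho1 hB hf frho hrf v.
rewrite mulmxBr mulmxBl mxE [X in _ + X]mxE -scalemxAr -scalemxAl [X in _ - X]mxE.
by congr (0 <= _); ring.
Qed.

(** The inverse of the transformation in [schur_resolves].  The new function is
strictly bounded by 1 because the Blaschke factor is. *)
Lemma schur_unresolves n (a g q : C) (W : 'M[C]_(1 + n)) (e c y e1 c1 : 'cV[C]_(1 + n)) psi :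
  `|a| < 1 -> `|g| < 1 -> 0 < q -> q ^+ 2 = 1 - g * g^* ->
  (forall i, [/\ e i 0 - g^* * c i 0 = q * (y i 0 - a^* * (W *m y) i 0),
     c i 0 - g * e i 0 = q * c1 i 0 & (W *m y) i 0 - a * y i 0 = e1 i 0]) ->
  (forall z, `|z| < 1 -> `|psi z| <= 1) ->
  (forall z, `|z| < 1 -> hol psi z) ->
  resolves W e1 c1 psi [::] ->
  exists phi : C -> C, [/\ forall z, `|z| < 1 -> `|phi z| < 1,
    forall z, `|z| < 1 -> hol phi z & resolves W e c phi [::]].
Proof.
move=> a1 g1 q0 qq H psi1 hpsi [h [K hK]].
pose f w := psi w * ((w - a) / (1 - a^* * w)).
pose phi w := (f w + g) / (1 + g^* * f w).
have m0 w : `|w| < 1 -> 1 - a^* * w != 0 by move=> w1; apply: moebius_den_neq0 => //; exact: ltW.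
have f1 w : `|w| < 1 -> `|f w| < 1.
  move=> w1; rewrite normrM; apply: le_lt_trans (ler_piMl _ (psi1 w w1)) _ => //.
  by rewrite normrM normfV ltr_pdivrMr ?normr_gt0 ?m0// mul1r moebius_lt.
have g1' : `|- g| < 1 by rewrite normrN.
have dE w : 1 + g^* * f w = 1 - (- g)^* * f w by rewrite rmorphN /= mulNr opprK.
have d0 w : `|w| < 1 -> 1 + g^* * f w != 0.
  by move=> w1; rewrite dE; apply: moebius_den_neq0 => //; apply: ltW; exact: f1.
have hf w : `|w| < 1 -> hol f w.
  move=> w1; have hp := hpsi w w1.
  have h2 := hol_div (@hol_subc _ id a w (@hol_id _ w)) (@hol_csub _ id a^* w (@hol_id _ w)) (m0 w w1).
  exact: (@holM _ _ _ w hp h2).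
exists phi; split.
- move=> w w1; rewrite normrM normfV ltr_pdivrMr ?normr_gt0 ?d0// mul1r dE.
  by rewrite -{1}[g]opprK moebius_lt// f1.
- move=> w w1; exact: (hol_div (@hol_addc _ f g w (hf w w1)) (@hol_cadd _ f g^* w (hf w w1)) (d0 w w1)).
exists (fun w => (q / (1 + g^* * f w)) *: (h w + (psi w * (1 - a * a^*) / (1 - a^* * w)) *: y)).
pose My := \sum_i `|y i 0|.
exists (q / (1 - `|g|) * (K + (1 / (1 - `|a|)) * My)) => w w1 _.
have [hE hb] := hK w w1 isT.
have dn0 := d0 w w1; have mn0 := m0 w w1.
split=> i.
  rewrite -scalemxAr mulmxDr -scalemxAr.
  have [] := H i; have := hE i.
  move: (W *m h w) (W *m y) => Wh Wy; rewrite !mxE.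
  move: (h w i 0) (Wh i 0) (Wy i 0) (y i 0) (e i 0) (c i 0) (e1 i 0) (c1 i 0).
  move=> hi Whi wi yi ei ci e1i c1i P1 P2 P3 P4.
  have q00 : q != 0 by rewrite gt_eqF.
  have eE : q * ei = yi - a^* * wi + g^* * c1i.
    apply: (mulfI q00); rewrite mulrA -expr2 qq mulrDr mulrCA -P2 -P3; ring.
  have cE : ci = g * ei + q * c1i by rewrite -P3; ring.
  have -> : w * (q / (1 + g^* * f w) * (hi + psi w * (1 - a * a^*) / (1 - a^* * w) * yi)) -
    q / (1 + g^* * f w) * (Whi + psi w * (1 - a * a^*) / (1 - a^* * w) * wi) =
    q / (1 + g^* * f w) * ((w * hi - Whi) +
    psi w * (1 - a * a^*) / (1 - a^* * w) * (w * yi - wi)) by ring.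
  have phig : phi w - g = f w * (1 - g * g^*) / (1 + g^* * f w).
    by rewrite /phi; field.
  have -> : phi w * ei - ci = (phi w - g) * ei - q * c1i by rewrite cE; ring.
  rewrite phig -qq P1.
  have -> : f w * q ^+ 2 / (1 + g^* * f w) * ei = f w * q / (1 + g^* * f w) * (q * ei) by ring.
  have fE : f w * (1 - a^* * w) = psi w * (w - a) by rewrite /f; field.
  rewrite eE -P4.
  have -> : psi w * (wi - a * yi) - c1i + psi w * (1 - a * a^*) / (1 - a^* * w) * (w * yi - wi) =
     psi w * (w - a) / (1 - a^* * w) * (yi - a^* * wi) - c1i by field.
  have -> : psi w * (w - a) / (1 - a^* * w) = f w by rewrite /f mulrA.
  by field.
move: (h w) hb => hw hb; rewrite mxE normrM.
rewrite ler_pM//.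
  rewrite normrM normfV (gtr0_norm q0) ler_pM2l// lef_pV2 ?posrE ?subr_gt0 ?normr_gt0//.
  by rewrite dE -(normrN g); apply: moebius_den => //; apply: ltW; exact: f1.
rewrite !mxE (le_trans (ler_normD _ _))// lerD// normrM.
rewrite ler_pM//; last first.
  by rewrite /My (bigD1 i)//= lerDl sumr_ge0.
rewrite normrM normfV ler_pM ?invr_ge0//; last first.
  rewrite lef_pV2 ?posrE ?subr_gt0 ?normr_gt0//.
  by apply: moebius_den => //; exact: ltW.
rewrite normrM mulr_ile1 ?psi1//.
have a2 : 0 <= 1 - `|a| ^+ 2 by rewrite subr_ge0 expr_le1// ltW.
by rewrite -normCK (ger0_norm a2) gerBl exprn_ge0.
Qed.

(** The first column of the Stein equation: the first row of W is (a, 0). *)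
Lemma stein_head n (a : C) (W A : 'M[C]_(1 + n)) z Z (e c : 'cV[C]_(1 + n)) i :
  W = block_mx a%:M 0 z Z -> stein W A e c ->
  A i 0 - a^* * (W *m A) i 0 = e i 0 * (e 0 0)^* - c i 0 * (c 0 0)^*.
Proof.
move=> WE; rewrite /stein => /matrixP/(_ i 0); rewrite mxE [X in _ + X]mxE.
rewrite [RHS]mxE [X in _ = _ + X]mxE !mul_col_row_adj => <-; congr (_ - _).
rewrite [RHS]mxE (bigD1 0)// adjE big1 /= ?addr0.
  rewrite mulrC; congr (_ * _^*); rewrite WE.
  have -> : (0 : 'I_(1 + n)) = lshift n 0 by apply: val_inj.
  by rewrite block_mxEul mxE eqxx mulr1n.
move=> j j0; rewrite adjE WE.
case: (@split_ordP 1 n j) j0 => k -> k0; first by case/eqP: k0; apply: val_inj; rewrite ord1.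
have -> : (0 : 'I_(1 + n)) = lshift n 0 by apply: val_inj.
by rewrite block_mxEur [X in X^*]mxE rmorph0 mulr0.
Qed.

(** Positivity of A_00 gives |c_0| <= |e_0|.  If e_0 = c_0 = 0 the first coordinate
is dropped; if |c_0| = |e_0| > 0 a unimodular constant is the solution; if
|c_0| < |e_0| the solution comes from [schur_unresolves]. *)
Lemma resolves_of_nonneg n : forall (Z A : 'M[C]_n) e c,
  stable Z -> stein Z A e c -> nonneg_form A ->
  exists phi : C -> C, [/\ forall z, `|z| < 1 -> hol phi z, resolves Z e c phi [::] &
    (forall z, `|z| < 1 -> `|phi z| < 1) \/
    (exists u : C, [/\ `|u| = 1, c = u *: e & phi = fun=> u])].
Proof.
elim: n => [|n IH] Z A e c sZ hA pA.
  exists (fun=> 0); split; first by move=> z _; exact: hol_cst.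
    by exists (fun=> 0), 0 => z _ _; split; case.
  by left=> z _; rewrite normr0.
have [a [z [Z' [ZE a1 sZ']]]] := @stable_block _ n Z sZ.
have hermA := stein_herm sZ hA.
have A00 : 0 <= A 0 0.
  have := pA (delta_mx 0 0); congr (0 <= _).
  rewrite trmx_delta map_delta_mx -rowE mxE (bigD1 0)//= big1 ?addr0.
    by rewrite !mxE !eqxx mulr1.
  by move=> j j0; rewrite [X in _ * X]mxE (negPf j0) mulr0.
have sh := stein_head _ ZE hA.
have ZA0 : (Z *m A) 0 0 = a * A 0 0.
  have -> : A 0 0 = (col 0 A) 0 0 by rewrite mxE.
  rewrite -(@mul_block_head _ n a z Z') -ZE mxE [RHS]mxE.
  by apply: eq_bigr => j _; rewrite mxE.
have h00 : (1 - a^* * a) * A 0 0 = `|e 0 0| ^+ 2 - `|c 0 0| ^+ 2.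
  by rewrite !normCK -sh ZA0; ring.
have a2 : 0 < 1 - a^* * a by rewrite mulrC -normCK subr_gt0 expr_lt1.
have ce : `|c 0 0| <= `|e 0 0|.
  by rewrite -ler_sqr ?nnegrE// -subr_ge0 -h00 mulr_ge0// ltW.
have [e0|e0] := eqVneq (e 0 0) 0.
  have c0 : c 0 0 = 0 by move: ce; rewrite e0 normr0 normr_le0 => /eqP.
  move: hA pA; rewrite ZE (col_mx_head0 e0) (col_mx_head0 c0) => hA pA.
  have [A' A'E hA'] := stein_zero_head a1 sZ' hA.
  move: pA; rewrite A'E => /nonneg_block0 pA'.
  have [phi [hphi rphi phi1]] := IH _ _ _ _ sZ' hA' pA'.
  exists phi; split => //; first exact: resolves_cons.
  case: phi1 => [|[u [u1 cu ->]]]; [by left|right].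
  by exists u; split => //; rewrite -!col_mx_head0 //; exact: (eq_scale_head0 e0 c0 cu).
move: ce; rewrite le_eqVlt => /orP[/eqP ce|ce].
  have A0 : A 0 0 = 0.
    apply: (mulfI (_ : 1 - a^* * a != 0)); first by rewrite gt_eqF.
    by rewrite h00 ce subrr mulr0.
  have Acol := nonneg_form_head0 hermA pA A0.
  have ec i : e i 0 * (e 0 0)^* = c i 0 * (c 0 0)^*.
    apply/eqP; rewrite -subr_eq0 -sh Acol.
    suff -> : (Z *m A) i 0 = 0 by rewrite mulr0 subrr.
    by rewrite mxE big1// => j _; rewrite Acol mulr0.
  have c0 : (c 0 0)^* != 0 by rewrite conjC_eq0 -normr_eq0 ce normr_eq0.
  pose u := (e 0 0)^* / (c 0 0)^*.
  have cu : c = u *: e.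
    apply/matrixP => i j; rewrite ord1 mxE /u mulrAC [_^* * _]mulrC ec mulfK//.
  exists (fun=> u); split; first by move=> w _; exact: hol_cst.
    exists (fun=> 0), 0 => w _ _; split=> i; last by rewrite mxE normr0.
    by rewrite mulmx0 cu !mxE mulr0 !subrr.
  right; exists u; split => //.
  by rewrite normrM normfV !norm_conjC ce mulfV// normr_eq0.
pose g := c 0 0 / e 0 0.
have gE : c 0 0 = g * e 0 0 by rewrite divfK.
have g1 : `|g| < 1.
  by rewrite normrM normfV ltr_pdivrMr ?normr_gt0// mul1r.
have [q [y [A' [e' [c' [[[q0 qq] AE hA' y0] H]]]]]] :=
  schur_step sZ ZE a1 sZ' g1 hA e0 gE.
have pA' : nonneg_form A'.
  by apply: (nonneg_form_reduce y0 (k := 1 - a * a^*)); rewrite -AE.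
have [psi [hpsi rpsi psi1]] := IH _ _ _ _ sZ' hA' pA'.
have psi1' w : `|w| < 1 -> `|psi w| <= 1.
  by case: psi1 => [h w1|[u [u1 _ ->]] _]; [exact/ltW/h|rewrite u1].
have rpsi' := @resolves_cons _ n a z Z' e' c' psi [::] rpsi.
rewrite -ZE in rpsi'.
have [phi [phi1 hphi rphi]] := schur_unresolves a1 g1 q0 qq H psi1' hpsi rpsi'.
by exists phi; split => //; left.
Qed.

End Main.

(** * Double power series and the coefficients of the kernel *)

Section Kernel.
Local Open Scope classical_set_scope.

Context {R : realType}.
Local Notation C := R[i].

Lemma partial_sum_seq (I : choiceType) (x : I -> C) (s : seq I) : uniq s ->
  exists B : {fset I}, (forall i, (i \in B) = (i \in s)) /\
    partial_sum x B = \sum_(i <- s) x i.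
Proof.
move=> us; exists (seq_fset tt s); split; first by move=> i; rewrite seq_fsetE.
rewrite /partial_sum -big_enum -(big_map val xpredT x) -enum_fsetE.
by apply: perm_big; rewrite (perm_trans (seq_fset_perm _ _))// undup_id.
Qed.

Definition rect_sum (a : nat -> nat -> C) (x y : C) m n :=
  \sum_(k < m) \sum_(l < n) a k l * x ^+ k * y ^+ l.

Lemma partial_sum_rect (a : nat -> nat -> C) x y m n :
  exists B : {fset nat * nat}, (forall k l, ((k, l) \in B) = ((k < m) && (l < n))%N) /\
    partial_sum (fun kl : nat * nat => a kl.1 kl.2 * x ^+ kl.1 * y ^+ kl.2) B =
      rect_sum a x y m n.
Proof.
have us : uniq [seq (k, l) | k <- iota 0 m, l <- iota 0 n].
  by apply: allpairs_uniq; rewrite ?iota_uniq// => -[a1 b1] [a2 b2].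
have [B [hB hs]] := partial_sum_seq (fun kl : nat * nat => a kl.1 kl.2 * x ^+ kl.1 * y ^+ kl.2) us.
exists B; split.
  move=> k l; rewrite hB; apply/allpairsP/andP => [[[u v] /= [+ + [-> ->]]]|[km ln]].
    by rewrite !mem_iota.
  by exists (k, l); rewrite !mem_iota /= km ln.
rewrite hs big_allpairs_dep /= /rect_sum -(big_mkord xpredT (fun k => \sum_(l < n) a k l * x ^+ k * y ^+ l)).
rewrite /index_iota subn0; apply: eq_bigr => k _.
by rewrite -(big_mkord xpredT (fun l => a k l * x ^+ k * y ^+ l)) /index_iota subn0.
Qed.

(** Unconditional convergence is used through two consequences: the sums over
large rectangles converge, and the terms are bounded, as the difference of two
partial sums close to the limit. *)
Lemma totally_cvg_rect (a : nat -> nat -> C) (x y L : C) :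
  (partial_sum (fun kl : nat * nat =>
     (a kl.1 kl.2 * x ^+ kl.1 * y ^+ kl.2 : C^o)) @ totally --> (L : C^o)) ->
  (forall e : C, 0 < e -> exists N, forall m n, (N <= m)%N -> (N <= n)%N ->
     `|rect_sum a x y m n - L| <= e) /\
  exists K : C, forall k l, `|a k l * x ^+ k * y ^+ l| <= K.
Proof.
move=> h.
have hA (e : C) : 0 < e -> exists A : {fset nat * nat}, forall B, (A `<=` B)%fset ->
    `|L - partial_sum (fun kl : nat * nat => (a kl.1 kl.2 * x ^+ kl.1 * y ^+ kl.2 : C^o)) B| <= e.
  move=> e0; have tF : Filter (@totally (nat * nat)%type) by have := @totally_filter (nat * nat)%type; move=> h1; exact: (@filter_filter _ _ h1).
  by move/cvgrPdist_le : h => /(_ e e0)[A _ hA]; exists A.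
have bnd (A : {fset nat * nat}) : exists N, forall k l, (k, l) \in A -> (k < N)%N && (l < N)%N.
  exists (\max_(p <- A) maxn p.1.+1 p.2.+1) => k l klA.
  rewrite -geq_max; exact: (@leq_bigmax_seq _ (enum_fset A) xpredT (fun p => maxn p.1.+1 p.2.+1) (k, l) klA isT).
split.
  move=> e e0; have [A hAe] := hA e e0; have [N hN] := bnd A.
  exists N => m n Nm Nn; have [B [hB <-]] := partial_sum_rect a x y m n.
  rewrite distrC; apply: hAe; apply/fsubsetP => -[k l] /hN/andP[kN lN].
  by rewrite hB (leq_trans kN Nm) (leq_trans lN Nn).
have [A hA1] := hA 1 ltr01.
pose T (p : nat * nat) := a p.1 p.2 * x ^+ p.1 * y ^+ p.2.
have sA := fset_uniq A.
exists (2 + \sum_(p <- enum_fset A) `|T p|) => k l.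
have S0 : 0 <= \sum_(p <- enum_fset A) `|T p| by rewrite sumr_ge0.
have [klA|klA] := boolP ((k, l) \in enum_fset A).
  rewrite (big_rem _ klA) /= addrCA -[leLHS]/(`|T (k, l)|) lerDl.
  by rewrite addr_ge0// sumr_ge0.
have [B0 [B0A s0]] := partial_sum_seq T sA.
have us : uniq ((k, l) :: enum_fset A) by rewrite /= klA.
have [B1 [B1A s1]] := partial_sum_seq T us.
have h0 : `|L - partial_sum T B0| <= 1.
  by apply: hA1; apply/fsubsetP => p pA; rewrite B0A.
have h1 : `|L - partial_sum T B1| <= 1.
  by apply: hA1; apply/fsubsetP => p pA; rewrite B1A inE pA orbT.
apply: (@le_trans _ _ 2); last by rewrite lerDl.
rewrite -[leLHS]/(`|T (k, l)|).
have -> : T (k, l) = (L - partial_sum T B0) - (L - partial_sum T B1).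
  by rewrite s0 s1 big_cons; ring.
by rewrite (le_trans (ler_normB _ _))// -[leRHS]/(1 + 1) lerD.
Qed.

(** Lexicographic induction on (k, l).  If all earlier coefficients vanish, then the
term of index (k, l) at s = r X, t = r Y dominates the others when X = Y^(l+1)
and Y is small: they sum up to a multiple of X^k Y^(l+1) + X^(k+1). *)
Lemma double_series_uniq (d : nat -> nat -> C) (K r : R) : 0 < r ->
  (forall k l, normc (d k l) * r ^+ (k + l) <= K) ->
  (forall s t : R, 0 < s -> s < r -> 0 < t -> t < r -> forall e : R, 0 < e ->
     exists N, forall n, (N <= n)%N -> normc (rect_sum d (s%:C)%C (t%:C)%C n n) <= e) ->
  forall k l, d k l = 0.
Proof.
move=> r0 dK hs.
have K0 : 0 <= K.
  by apply: le_trans (dK 0%N 0%N); rewrite mulr_ge0 ?normc_ge0// exprn_ge0// ltW.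
have geom n : \sum_(j < n) (2^-1 : R) ^+ j <= 2.
  suff -> : \sum_(j < n) (2^-1 : R) ^+ j = 2 - 2 * 2^-1 ^+ n.
    by rewrite gerBl mulr_ge0// exprn_ge0.
  elim: n => [|n IH]; first by rewrite big_ord0 expr0 mulr1 subrr.
  by rewrite big_ord_recr IH /= exprS; field.
suff key k0 l0 : (forall k l, (k < k0)%N -> d k l = 0) ->
    (forall l, (l < l0)%N -> d k0 l = 0) -> d k0 l0 = 0.
  move=> k; elim/ltn_ind : k => k IHk l; elim/ltn_ind: l => l IHl.
  by apply: key => // k' l' kk'; exact: IHk.
move=> dk dl.
pose c0 := K * 2 ^+ k0.+1 * 2 ^+ l0.+1 * 4.
have c00 : 0 <= c0 by rewrite !mulr_ge0// exprn_ge0.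
have main (X Y : R) : 0 < X -> X <= 2^-1 -> 0 < Y -> Y <= 2^-1 ->
    normc (d k0 l0) * r ^+ (k0 + l0) * (X ^+ k0 * Y ^+ l0) <=
    c0 * (X ^+ k0 * Y ^+ l0.+1 + X ^+ k0.+1).
  move=> X0 X1 Y0 Y1; apply/ler_addgt0Pr => e e0.
  have rX : r * X < r by rewrite -[ltRHS]mulr1 ltr_pM2l//; lra.
  have rY : r * Y < r by rewrite -[ltRHS]mulr1 ltr_pM2l//; lra.
  have [N hN] := hs (r * X) (r * Y) (mulr_gt0 r0 X0) rX (mulr_gt0 r0 Y0) rY e e0.
  pose n := (N + k0 + l0).+1.
  have Nn : (N <= n)%N by rewrite /n -addnA leqW// leq_addr.
  have kn : (k0 < n)%N by rewrite /n ltnS (leq_trans (leq_addl N k0))// leq_addr.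
  have ln : (l0 < n)%N by rewrite /n ltnS leq_addl.
  pose T k l := d k l * ((r * X)%:C)%C ^+ k * ((r * Y)%:C)%C ^+ l.
  have nT k l : normc (T k l) = normc (d k l) * r ^+ (k + l) * (X ^+ k * Y ^+ l).
    rewrite /T !normcM !normcX.
    by rewrite !normc_pos ?mulr_gt0// exprD !exprMn; ring.
  (* a geometric majorant of all terms other than the one of index (k0, l0) *)
  pose E k l := c0 / 4 * (X ^+ k0 * Y ^+ l0.+1 + X ^+ k0.+1) * (2^-1 ^+ k * 2^-1 ^+ l).
  have XYk0 k l : 0 <= X ^+ k * Y ^+ l by rewrite mulr_ge0// exprn_ge0// ltW.
  have E0 k l : 0 <= E k l.
    rewrite !mulr_ge0 ?exprn_ge0// ?invr_ge0//.
    by rewrite addr_ge0// ?exprn_ge0// ltW.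
  have pow (Z : R) k k1 : 0 < Z -> Z <= 2^-1 -> (k1 <= k)%N ->
      Z ^+ k <= Z ^+ k1 * (2 ^+ k1 * 2^-1 ^+ k).
    move=> Z0 Z1 kk; rewrite -{1}(subnKC kk) exprD ler_pM2l ?exprn_gt0//.
    rewrite -{2}(subnKC kk) exprD mulrA -exprMn divff// expr1n mul1r.
    by rewrite lerXn2r ?nnegrE// ltW.
  have TE k l : (k, l) != (k0, l0) -> normc (T k l) <= E k l.
    move=> kl.
    have [kk|kk] := ltnP k k0; first by rewrite nT dk// normc0 !mul0r.
    have [ll|ll] := boolP ((k == k0) && (l < l0)%N).
      by case/andP: ll => /eqP -> ll; rewrite nT dl// normc0 !mul0r.
    rewrite nT (@le_trans _ _ (K * (X ^+ k * Y ^+ l)))//; first by rewrite ler_wpM2r// dK.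
    rewrite /E /c0.
    rewrite (_ : K * 2 ^+ k0.+1 * 2 ^+ l0.+1 * 4 / 4 * (X ^+ k0 * Y ^+ l0.+1 + X ^+ k0.+1) *
      (2^-1 ^+ k * 2^-1 ^+ l) = K * ((X ^+ k0 * Y ^+ l0.+1 + X ^+ k0.+1) *
      (2 ^+ k0.+1 * 2 ^+ l0.+1 * (2^-1 ^+ k * 2^-1 ^+ l)))); last by field.
    rewrite ler_wpM2l// mulrDl.
    have p1 : 1 <= 2 ^+ l0.+1 :> R by rewrite exprn_ege1 ?ler1n.
    have p2 : 1 <= 2 ^+ k0.+1 :> R by rewrite exprn_ege1 ?ler1n.
    have h0 k' : 0 <= 2^-1 ^+ k' :> R by rewrite exprn_ge0.
    have [kk1|kk1] := ltnP k0 k.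
      rewrite (@le_trans _ _ (X ^+ k0.+1 * (2 ^+ k0.+1 * 2 ^+ l0.+1 * (2^-1 ^+ k * 2^-1 ^+ l))))//.
        rewrite (_ : _ * (_ * _ * _) = (X ^+ k0.+1 * (2 ^+ k0.+1 * 2^-1 ^+ k)) * (2 ^+ l0.+1 * 2^-1 ^+ l)); last by ring.
        rewrite ler_pM ?exprn_ge0 ?(ltW X0) ?(ltW Y0)// ?pow//.
        have := @pow Y l 0%N Y0 Y1 isT; rewrite !expr0 !mul1r => /le_trans; apply.
        by rewrite ler_peMl.
      rewrite lerDr !mulr_ge0// ?exprn_ge0 ?(ltW X0) ?(ltW Y0)//.
    have kE : k = k0 by apply/eqP; rewrite eqn_leq kk kk1.
    rewrite kE eqxx /= -leqNgt leq_eqVlt in ll.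
    have {}ll : (l0 < l)%N.
      by case/orP: ll => // /eqP ll; move: kl; rewrite kE ll eqxx.
    rewrite kE.
    rewrite (@le_trans _ _ (X ^+ k0 * Y ^+ l0.+1 * (2 ^+ k0.+1 * 2 ^+ l0.+1 * (2^-1 ^+ k0 * 2^-1 ^+ l))))//.
      rewrite (_ : _ * _ * (_ * _ * _) = (X ^+ k0 * (2 ^+ k0.+1 * 2^-1 ^+ k0)) * (Y ^+ l0.+1 * (2 ^+ l0.+1 * 2^-1 ^+ l))); last by ring.
      rewrite ler_pM ?exprn_ge0 ?(ltW X0) ?(ltW Y0)// ?pow//.
      rewrite ler_peMr ?exprn_ge0 ?(ltW X0)// exprS -mulrA -exprMn divff// expr1n mulr1.
      by rewrite ler1n.
    rewrite lerDl !mulr_ge0// ?exprn_ge0 ?(ltW X0) ?(ltW Y0)//.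
  have sumE : \sum_(k < n) \sum_(l < n) E k l <= c0 * (X ^+ k0 * Y ^+ l0.+1 + X ^+ k0.+1).
    rewrite /E; under eq_bigr do rewrite -mulr_sumr -mulr_sumr.
    rewrite -mulr_sumr -mulr_suml.
    set A := X ^+ k0 * _ + _; have A0 : 0 <= A.
      by rewrite addr_ge0// ?exprn_ge0 ?(ltW X0)// XYk0.
    set S := \sum_(i < n) _.
    have S0 : 0 <= S by rewrite sumr_ge0// => i _; rewrite exprn_ge0.
    have S2 : S <= 2 by exact: geom.
    have : S * S <= 2 * 2 by rewrite ler_pM.
    have : 0 <= c0 * A by rewrite mulr_ge0.
    nra.
  rewrite -nT.
  pose o0 := Ordinal kn; pose p0 := Ordinal ln.
  have -> : T k0 l0 = rect_sum d ((r * X)%:C)%C ((r * Y)%:C)%C n n -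
     \sum_(k < n) \sum_(l < n) (if (k == o0) && (l == p0) then 0 else T k l).
    rewrite /rect_sum -sumrB.
    rewrite (bigD1 o0)//= [X in _ + X]big1 ?addr0; last first.
      move=> i i0; rewrite -sumrB big1// => j _.
      by rewrite (negPf i0) /= subrr.
    rewrite -sumrB (bigD1 p0)//= [X in _ + X]big1 ?addr0; last first.
      by move=> j j0; rewrite (negPf j0) andbF subrr.
    by rewrite !eqxx /= subr0.
  rewrite (le_trans (le_normcD _ _))// addrC lerD//; last exact: hN.
  rewrite [normc (- _)]normcN; apply: le_trans sumE.
  have nsum (F : 'I_n -> C) (G : 'I_n -> R) : (forall i, normc (F i) <= G i) ->
      normc (\sum_i F i) <= \sum_i G i.
    move=> FG; rewrite -lecR -normcR (le_trans (ler_norm_sum _ _ _))// rmorph_sum /=.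
    by apply: ler_sum => i _; rewrite normcR lecR.
  apply: (nsum) => k; apply: (nsum) => l.
  case: ifPn => [_|kl]; first by rewrite normc0.
  by apply: TE; apply: contraNneq kl => -[kk ll]; apply/andP; split; apply/eqP/val_inj.
apply: eq0_normc; apply/eqP; rewrite eq_le normc_ge0 andbT.
set w := normc (d k0 l0) * r ^+ (k0 + l0).
have w0 : w <= 0.
  apply/ler_addgt0Pr => e e0; rewrite add0r.
  pose Y := Num.min 2^-1 (e / (2 * c0 + 1)).
  have Y0 : 0 < Y by rewrite lt_min invr_gt0 ltr0n /= divr_gt0 // ltr_wpDl // mulr_ge0.
  have Y1 : Y <= 2^-1 by rewrite ge_min lexx.
  have Ye : Y * (2 * c0 + 1) <= e.
    by rewrite -ler_pdivlMr ?ltr_wpDl ?mulr_ge0// ge_min lexx orbT.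
  have X0 : 0 < Y ^+ l0.+1 by rewrite exprn_gt0.
  have X1 : Y ^+ l0.+1 <= 2^-1.
    by rewrite exprS (le_trans _ Y1)// ler_piMr ?(ltW Y0)// exprn_ile1 ?(ltW Y0)//; lra.
  have := main _ _ X0 X1 Y0 Y1; rewrite -/w.
  set x := Y ^+ l0.+1 in X0 X1 *.
  rewrite (_ : c0 * _ = 2 * c0 * Y * (x ^+ k0 * Y ^+ l0)).
    by rewrite ler_pM2r ?mulr_gt0 ?exprn_gt0//; lra.
  have xE : x = Y * Y ^+ l0 by rewrite /x exprS.
  transitivity (2 * c0 * (Y * Y ^+ l0) * x ^+ k0); last by ring.
  by rewrite -xE exprS; ring.
by move: w0; rewrite /w pmulr_lle0// exprn_gt0.
Qed.

(** The coefficients of y f and of x f, where a are the coefficients of f(x, y). *)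
Definition shift_col (a : nat -> nat -> C) k l := if l is l'.+1 then a k l' else 0.
Definition shift_row (a : nat -> nat -> C) k l := if k is k'.+1 then a k' l else 0.

Lemma rect_sum_shift_col a x y m n : rect_sum (shift_col a) x y m n.+1 = y * rect_sum a x y m n.
Proof.
rewrite /rect_sum mulr_sumr; apply: eq_bigr => k _.
rewrite big_ord_recl /= !mul0r add0r mulr_sumr; apply: eq_bigr => l _.
by rewrite /= exprS; ring.
Qed.

Lemma rect_sum_shift_row a x y m n : rect_sum (shift_row a) x y m.+1 n = x * rect_sum a x y m n.
Proof.
rewrite /rect_sum big_ord_recl big1 ?add0r; last by move=> l _; rewrite /= !mul0r.
rewrite mulr_sumr; apply: eq_bigr => k _; rewrite mulr_sumr; apply: eq_bigr => l _.
by rewrite /= exprS; ring.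
Qed.

Lemma rect_sum_delta (x y : C) m n :
  rect_sum (fun k l => ((k == 0%N) && (l == 0%N))%:R) x y m.+1 n.+1 = 1.
Proof.
rewrite /rect_sum big_ord_recl [X in _ + X]big1 ?addr0.
  rewrite big_ord_recl [X in _ + X]big1 ?addr0; first by rewrite !expr0 !mulr1.
  by move=> l _; rewrite /= !mul0r.
by move=> k _; rewrite big1// => l _; rewrite /= !mul0r.
Qed.

(** Real increments s and t suffice to determine the coefficients. *)
Lemma kernel_expansion_near (al be : C) a : `|al| < 1 -> `|be| < 1 ->
  kernel_expansion al be a -> exists2 r : R, 0 < r & r <= 1 /\
  forall s t : R, 0 < s -> s < r -> 0 < t -> t < r ->
   exists L : C, (1 - (al + (s%:C)%C) * (be^* + (t%:C)%C)) * L = 1 /\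
  (partial_sum (fun kl : nat * nat =>
     (a kl.1 kl.2 * ((s%:C)%C) ^+ kl.1 * ((t%:C)%C) ^+ kl.2 : C^o)) @ totally --> (L : C^o)).
Proof.
move=> a1 b1 [[P Q] /= [hP hQ] hPQ].
move/nbhs_ballP : hP => [e1 /real_gt0[r1 r10 ->] h1].
move/nbhs_ballP : hQ => [e2 /real_gt0[r2 r20 ->] h2].
pose r := Num.min (Num.min r1 r2) (Num.min (1 - normc al) (1 - normc be)).
have a1' : normc al < 1 by rewrite -norm_lt1E.
have b1' : normc be < 1 by rewrite -norm_lt1E.
have r0 : 0 < r by rewrite !lt_min r10 r20 !subr_gt0 a1'.
have [rr1 rr2 ra rb] : [/\ r <= r1, r <= r2, r <= 1 - normc al & r <= 1 - normc be].
  by rewrite !ge_min !lexx !orbT.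
exists r => //; split; first by have := normc_ge0 al; lra.
move=> s t s0 sr t0 tr.
have zs : normc (al + (s%:C)%C) < 1 by rewrite (le_lt_trans (le_normcD _ _))// normc_pos//; lra.
have wt : normc (be + (t%:C)%C) < 1 by rewrite (le_lt_trans (le_normcD _ _))// normc_pos//; lra.
have conjt : ((t%:C)%C : C)^* = (t%:C)%C.
  by apply: conj_Creal; apply: gtr0_real; exact: realC_gt0.
exists ((1 - (al + (s%:C)%C) * (be + (t%:C)%C)^*)^-1); split.
  rewrite rmorphD /= conjt divff// subr_eq0; apply: contraTneq zs => h.
  rewrite -leNgt.
  have : normc ((al + (s%:C)%C) * (be^* + (t%:C)%C)) = 1 by rewrite -h normc1.
  have -> : be^* + (t%:C)%C = (be + (t%:C)%C)^* by rewrite rmorphD /= conjt.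
  rewrite normcM [normc (_^*)]normc_conj => E.
  by have := normc_ge0 (al + (s%:C)%C); nra.
have := hPQ (al + (s%:C)%C, be + (t%:C)%C).
rewrite /= => H; have /H : P (al + (s%:C)%C) /\ Q (be + (t%:C)%C).
  split; [apply: h1|apply: h2]; rewrite /ball /= opprD addrA subrr add0r normrN normcR ltcR normc_pos//; lra.
by rewrite (addrC al) addrK (addrC be) addrK conjt.
Qed.

(** The coefficients of (1 - z conj(w)) * 1 / (1 - z conj(w)) = 1, expanded with
z = al + x and conj(w) = conj(be) + y. *)
Lemma kernel_coef_rec (al be : C) a : `|al| < 1 -> `|be| < 1 ->
  kernel_expansion al be a -> forall k l,
  a k l - (al * be^* * a k l + al * shift_col a k l + be^* * shift_row a k l + shift_row (shift_col a) k l)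
  = ((k == 0%N) && (l == 0%N))%:R.
Proof.
move=> a1 b1 hk k l; apply/eqP; rewrite -subr_eq0; apply/eqP.
have [r r0 [r1 H]] := kernel_expansion_near a1 b1 hk.
have a1' : normc al < 1 by rewrite -norm_lt1E.
have b1' : normc (be^*) < 1 by rewrite normc_conj -norm_lt1E.
pose d k l := a k l - (al * be^* * a k l + al * shift_col a k l + be^* * shift_row a k l + shift_row (shift_col a) k l)
  - ((k == 0%N) && (l == 0%N))%:R.
pose q := r / 2.
have q0 : 0 < q by rewrite divr_gt0.
have qr : q < r by rewrite /q; lra.
have [L [_ hL]] := H q q q0 qr q0 qr.
have [_ [K hK]] := totally_cvg_rect hL.
have [k1 KE k10] := leC_real (le_trans (normr_ge0 _) (hK 0%N 0%N) : (0%:C)%C <= K).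
have {}hK i j : normc (a i j) * q ^+ (i + j) <= k1.
  by have := hK i j; rewrite KE normcR lecR !normcM !normcX normc_pos// -mulrA -exprD.
have hKl i j : normc (shift_col a i j) * q ^+ (i + j) <= k1.
  case: j => [|j]; first by rewrite [shift_col _ _ _]/(0 : C) normc0 mul0r.
  rewrite addnS exprSr mulrA (le_trans _ (hK i j))// ler_piMr//; last lra.
  by rewrite mulr_ge0 ?normc_ge0// exprn_ge0// ltW.
have hKk i j : normc (shift_row a i j) * q ^+ (i + j) <= k1.
  case: i => [|i]; first by rewrite [shift_row _ _ _]/(0 : C) normc0 mul0r.
  rewrite addSn exprSr mulrA (le_trans _ (hK i j))// ler_piMr//; last lra.
  by rewrite mulr_ge0 ?normc_ge0// exprn_ge0// ltW.
have hKkl i j : normc (shift_row (shift_col a) i j) * q ^+ (i + j) <= k1.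
  case: i => [|i]; first by rewrite [shift_row _ _ _]/(0 : C) normc0 mul0r.
  rewrite addSn exprSr mulrA (le_trans _ (hKl i j))// ler_piMr//; last lra.
  by rewrite mulr_ge0 ?normc_ge0// exprn_ge0// ltW.
apply: (@double_series_uniq d (5 * k1 + 1) q q0).
  move=> i j; set Q := q ^+ (i + j).
  have Q0 : 0 <= Q by rewrite exprn_ge0// ltW.
  have Q1 : Q <= 1 by rewrite exprn_ile1 ?(ltW q0)//; lra.
  have := hK i j; have := hKl i j; have := hKk i j; have := hKkl i j; rewrite -/Q.
  rewrite /d; move: (a i j) (shift_col a i j) (shift_row a i j) (shift_row _ i j) => A1 A2 A3 A4 h4 h3 h2 h1.
  have dn : normc (((i == 0%N) && (j == 0%N))%:R : C) <= 1.
    by case: (_ && _); rewrite ?normc0 ?normc1.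
  have sub3 (u v : C) : normc (u - v) <= normc u + normc v.
    by rewrite (le_trans (le_normcD _ _))// [normc (- v)]normcN.
  apply: (@le_trans _ _ ((normc A1 + (normc A1 + normc A2 + normc A3 + normc A4) + 1) * Q)); last by nra.
  rewrite ler_wpM2r// (le_trans (sub3 _ _))// lerD// (le_trans (sub3 _ _))// lerD//.
  have b0 := normc_ge0 (be^*); have a0 := normc_ge0 al.
  rewrite (le_trans (le_normcD _ _))// lerD// (le_trans (le_normcD _ _))// lerD//.
    rewrite (le_trans (le_normcD _ _))// lerD//.
      rewrite !normcM ler_piMl ?normc_ge0// mulr_ile1//; exact: ltW.
    by rewrite normcM ler_piMl ?normc_ge0// ltW.
  by rewrite normcM ler_piMl ?normc_ge0// ltW.
move=> s t s0 sq t0 tq e e0.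
have sr : s < r by lra.
have tr : t < r by lra.
clear L hL; have [L [LE hL]] := H s t s0 sr t0 tr.
have [hN _] := totally_cvg_rect hL.
have e5 : 0 < e / 5 by rewrite divr_gt0.
have [N {}hN] := hN _ (realC_gt0 e5).
exists N.+1 => -[//|n] Nn.
have n1 : (N <= n.+1)%N by rewrite ltnW.
set x := (s%:C)%C; set y := (t%:C)%C.
have dE : rect_sum d x y n.+1 n.+1 = rect_sum a x y n.+1 n.+1 -
   (al * be^* * rect_sum a x y n.+1 n.+1 + al * (y * rect_sum a x y n.+1 n)
    + be^* * (x * rect_sum a x y n n.+1) + x * (y * rect_sum a x y n n)) - 1.
  rewrite -(rect_sum_delta x y n n) -2!rect_sum_shift_col -2!rect_sum_shift_row /rect_sum.
  rewrite !mulr_sumr -!big_split -!sumrB; apply: eq_bigr => i _.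
  rewrite !mulr_sumr -!big_split -!sumrB; apply: eq_bigr => j _.
  by rewrite /d /=; ring.
have {}hN m p : (N <= m)%N -> (N <= p)%N -> normc (rect_sum a x y m p - L) <= e / 5.
  by move=> Nm Np; rewrite -lecR -normcR; exact: hN.
have -> : rect_sum d x y n.+1 n.+1 = (rect_sum a x y n.+1 n.+1 - L) -
   (al * be^* * (rect_sum a x y n.+1 n.+1 - L) + al * (y * (rect_sum a x y n.+1 n - L))
    + be^* * (x * (rect_sum a x y n n.+1 - L)) + x * (y * (rect_sum a x y n n - L))).
  by rewrite dE -{1}LE; ring.
have := hN n.+1 n.+1 n1 n1; have := hN n.+1 n n1 Nn; have := hN n n.+1 Nn n1; have := hN n n Nn Nn.
move: (_ - L) (_ - L) (_ - L) (_ - L) => A4 A3 A2 A1 h4 h3 h2 h1.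
have x1 : normc x <= 1 by rewrite normc_pos//; lra.
have y1 : normc y <= 1 by rewrite normc_pos//; lra.
have pm (u v : C) (E : R) : normc u <= 1 -> normc v <= E -> normc (u * v) <= E.
  by move=> u1 vE; rewrite normcM (le_trans _ vE)// ler_piMl ?normc_ge0.
have -> : e = e / 5 + (e / 5 + e / 5 + e / 5 + e / 5) by field.
rewrite (le_trans (le_normcD _ _))// lerD// [normc (- _)]normcN.
rewrite (le_trans (le_normcD _ _))// lerD//; last by apply: (pm) => //; exact: pm.
rewrite (le_trans (le_normcD _ _))// lerD//; last first.
  by apply: (pm); [exact: ltW|exact: pm].
rewrite (le_trans (le_normcD _ _))// lerD//.
  by rewrite -mulrA; apply: (pm); [exact: ltW|apply: (pm) => //; exact: ltW].
by apply: (pm); [exact: ltW|exact: pm].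
Qed.

End Kernel.

(** * The block matrices of the problem *)

Section Blocks.
Local Open Scope classical_set_scope.
Local Open Scope sesquilinear_scope.

Context {R : realType}.
Local Notation C := R[i].

Lemma sum_eq_succ m (k : 'I_m) (G : nat -> C) :
  \sum_(p < m) (k == p.+1 :> nat)%:R * G p = if k : nat is k'.+1 then G k' else 0.
Proof.
case: k => -[|k] km /=; first by rewrite big1// => p _; rewrite mul0r.
have km' : (k < m)%N by exact: ltnW.
rewrite (bigD1 (Ordinal km'))//= eqxx mul1r big1 ?addr0// => p pk.
rewrite (_ : (k.+1 == p.+1) = false) ?mul0r//.
by apply: contraNF pk => /eqP[kp]; apply/eqP/val_inj.
Qed.

Definition jordan m (al : C) : 'M[C]_m :=
  \matrix_(k, l) (al * (k == l)%:R + (k == l.+1 :> nat)%:R).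

Lemma jordan_mul m n al (F : nat -> nat -> C) :
  jordan m al *m \matrix_(k < m, l < n) F k l =
  \matrix_(k < m, l < n) (al * F k l + shift_row F k l).
Proof.
apply/matrixP => k l; rewrite !mxE.
under eq_bigr do rewrite !mxE mulrDl.
rewrite big_split /= (sum_eq_succ k (F^~ l)); congr (_ + _).
rewrite (bigD1 k)//= eqxx mulr1 big1 ?addr0// => p pk.
by rewrite eq_sym (negPf pk) mulr0 mul0r.
Qed.

Lemma mul_jordan_adj m n al (F : nat -> nat -> C) :
  (\matrix_(k < m, l < n) F k l) *m (jordan n al) ^t* =
  \matrix_(k < m, l < n) (al^* * F k l + shift_col F k l).
Proof.
apply/matrixP => k l; rewrite !mxE.
transitivity (\sum_(p < n) (al^* * (l == p)%:R + (l == p.+1 :> nat)%:R) * F k p).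
  apply: eq_bigr => p _; rewrite !mxE rmorphD rmorphM /= !rmorph_nat mulrC //.
under eq_bigr do rewrite mulrDl.
rewrite big_split /= (sum_eq_succ l (F k)); congr (_ + _).
rewrite (bigD1 l)//= eqxx mulr1 big1 ?addr0// => p pk.
by rewrite eq_sym (negPf pk) mulr0 mul0r.
Qed.

Lemma jordan_toeplitz m al c : jordan m al *m toeplitz_mx m c = toeplitz_mx m c *m jordan m al.
Proof.
rewrite /toeplitz_mx (@jordan_mul m m al (fun k l => if (l <= k)%N then c (k - l)%N else 0)).
apply/matrixP => k l; rewrite !mxE.
under eq_bigr do rewrite !mxE mulrDr.
rewrite big_split /=; congr (_ + _).
  rewrite (bigD1 l)//= eqxx mulr1 mulrC big1 ?addr0// => p pk.
  by rewrite (negPf pk) !mulr0.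
have [lm|lm] := ltnP l.+1 m.
  rewrite (bigD1 (Ordinal lm))//= eqxx mulr1 big1 ?addr0; last first.
    move=> p pk; rewrite (_ : (p == l.+1 :> nat) = false) ?mulr0//.
    by apply: contraNF pk => /eqP pl; apply/eqP/val_inj.
  by case: k => -[|k] km //=.
rewrite big1; last first.
  move=> p _; rewrite (_ : (p == l.+1 :> nat) = false) ?mulr0//.
  by apply/negbTE; rewrite neq_ltn (leq_trans (ltn_ord p) lm).
case: k => -[|k] km //=; rewrite ifN//.
by rewrite -ltnNge -ltnS (leq_trans km lm).
Qed.

Context {N : nat} (n : 'I_N -> nat).
Local Notation dim := (\sum_(i < N) n i)%N.

Lemma adj_mxblock (B : forall i j, 'M[C]_(n i, n j)) :
  (\mxblock_(i < N, j < N) B i j) ^t* = \mxblock_(i < N, j < N) (B j i) ^t*.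
Proof. by apply/matrixP => s t; rewrite !mxE. Qed.

Lemma adj_mxcol (B : forall i, 'cV[C]_(n i)) :
  (\mxcol_(i < N) B i) ^t* = \mxrow_(i < N) (B i) ^t*.
Proof. by apply/matrixP => s t; rewrite !mxE. Qed.

Lemma adj_mxdiag (B : forall i, 'M[C]_(n i)) :
  (\mxdiag_(i < N) B i) ^t* = \mxdiag_(i < N) (B i) ^t*.
Proof.
rewrite /mxdiag adj_mxblock; apply/eq_mxblock => i j.
have [->|ij] := eqVneq i j; first by rewrite !conform_mx_id.
by rewrite adj0.
Qed.

(** Multiplication by the variable, on the vector of jets at the nodes. *)
Definition nodes_mx (al : 'I_N -> C) : 'M[C]_dim := \mxdiag_(i < N) jordan (n i) (al i).
Definition jet_one : 'cV[C]_dim := \mxcol_(i < N) \col_(k < n i) (k == 0%N :> nat)%:R.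
Definition jet_data (c : 'I_N -> nat -> C) : 'cV[C]_dim :=
  \mxcol_(i < N) \col_(k < n i) c i k.

Lemma stable_nodes al : (forall i, `|al i| < 1) -> stable (nodes_mx al).
Proof.
move=> h; split.
  apply/is_trig_mxblockP; split=> [i j ij|i].
    by case: eqVneq ij => // ->; rewrite ltnn.
  rewrite eqxx conform_mx_id; apply/is_trig_mxP => k l kl.
  rewrite mxE (_ : (k == l) = false) ?mulr0 ?add0r; last first.
    by apply: contraTF kl => /eqP ->; rewrite ltnn.
  by rewrite (_ : (k == l.+1 :> nat) = false)// ltn_eqF// ltnS ltnW.
move=> s; rewrite /nodes_mx /mxdiag mxE eqxx conform_mx_id mxE eqxx mulr1.
by rewrite ltn_eqF// addr0.
Qed.

Lemma stein_Gamma al a : (forall i j k l,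
    a i j k l - (al i * (al j)^* * a i j k l + al i * shift_col (a i j) k l +
      (al j)^* * shift_row (a i j) k l + shift_row (shift_col (a i j)) k l) = ((k == 0%N) && (l == 0%N))%:R) ->
  Gamma_mx n a - nodes_mx al *m Gamma_mx n a *m (nodes_mx al) ^t* = jet_one *m jet_one ^t*.
Proof.
move=> h; rewrite /Gamma_mx /nodes_mx adj_mxdiag mul_mxdiag_mxblock mul_mxblock_mxdiag.
rewrite -mxblockB adj_mxcol mul_mxcol_mxrow; apply/eq_mxblock => i j.
rewrite jordan_mul.
rewrite (@mul_jordan_adj _ _ _ (fun k l => al i * a i j k l + shift_row (a i j) k l)); apply/matrixP => k l.
rewrite !mxE big_ord1 !mxE rmorph_nat -natrM mulnb -(h i j).
case: (l : nat) => [|l'] /=; case: (k : nat) => [|k'] /=; ring.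
Qed.

Lemma C_mx_nodes al c : C_mx n c *m nodes_mx al = nodes_mx al *m C_mx n c.
Proof.
rewrite /C_mx /nodes_mx {2}/mxdiag [in RHS]/mxdiag.
rewrite mul_mxdiag_mxblock (mul_mxdiag_mxblock (fun i => jordan (n i) (al i))).
apply/eq_mxblock => i j.
have [->|ij] := eqVneq i j; first by rewrite !conform_mx_id jordan_toeplitz.
by rewrite !mulmx0.
Qed.

Lemma C_mx_jet_one c : C_mx n c *m jet_one = jet_data c.
Proof.
rewrite /C_mx mul_mxdiag_mxcol; apply/eq_mxcol => i.
apply/matrixP => k j; rewrite !mxE.
have n0 : (0 < n i)%N by exact: leq_ltn_trans (ltn_ord k).
rewrite (bigD1 (Ordinal n0))//= !mxE /= subn0 mulr1 big1 ?addr0// => p p0.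
rewrite !mxE (_ : (p == 0%N :> nat) = false) ?mulr0//.
by apply: contraNF p0 => /eqP p0; apply/eqP/val_inj.
Qed.

Lemma stein_pick al a c : (forall i j k l,
    a i j k l - (al i * (al j)^* * a i j k l + al i * shift_col (a i j) k l +
      (al j)^* * shift_row (a i j) k l + shift_row (shift_col (a i j)) k l) = ((k == 0%N) && (l == 0%N))%:R) ->
  stein (nodes_mx al) (pick_mx n a c) jet_one (jet_data c).
Proof.
move=> /stein_Gamma h; rewrite /stein /pick_mx.
move: h; rewrite -!C_mx_jet_one adjM.
move: (Gamma_mx n a) (C_mx n c) (C_mx_nodes al c) => G D DZ h.
have DZ' : (nodes_mx al) ^t* *m D ^t* = D ^t* *m (nodes_mx al) ^t* by rewrite -!adjM DZ.
rewrite !mulmxBr !mulmxBl.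
have -> : D *m jet_one *m (jet_one ^t* *m D ^t*) = D *m (jet_one *m jet_one ^t*) *m D ^t*.
  by rewrite !mulmxA.
rewrite -h mulmxBr mulmxBl.
have -> : nodes_mx al *m (D *m G *m D ^t*) *m (nodes_mx al) ^t* =
   D *m (nodes_mx al *m G *m (nodes_mx al) ^t*) *m D ^t*.
  by rewrite !mulmxA -DZ -!mulmxA DZ'.
move: (D *m (nodes_mx al *m G *m (nodes_mx al) ^t*) *m D ^t*) => W.
move: (D *m G *m D ^t*) (nodes_mx al *m G *m (nodes_mx al) ^t*) => X Y.
by apply/matrixP => i j; rewrite !mxE; ring.
Qed.

Lemma mul_jordan_col m al (f : nat -> C) (k : 'I_m) j :
  (jordan m al *m (\col_(k < m) f k)) k j = al * f k + (if k : nat is k'.+1 then f k' else 0).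
Proof.
by rewrite (@jordan_mul m 1 al (fun k _ => f k)) mxE /shift_row; case: (k : nat).
Qed.

(** The k-th entry of the resolvent at a node is the value of this quotient at
k + 1. *)
Definition taylor (c : nat -> C) al (phi : C -> C) k z :=
  (phi z - \sum_(j < k) c j * (z - al) ^+ j) / (z - al) ^+ k.

Lemma taylorS c al phi k z : z - al != 0 ->
  (z - al) * taylor c al phi k.+1 z = taylor c al phi k z - c k.
Proof.
move=> za; rewrite /taylor big_ord_recr /= exprS; field.
by rewrite za expf_neq0.
Qed.

(** The quotient of the highest order is bounded near al by the hypothesis, and away
from al because phi is.  The lower ones follow from [taylorS]. *)
Lemma taylor_bound (c : nat -> C) (al : C) (phi : C -> C) (m : nat) (k : nat) (r K : R) : (k < m)%N -> `|al| < 1 ->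
  (forall z, `|z| < 1 -> `|phi z| <= 1) -> 0 < r ->
  (forall z, normc (z - al) < r -> normc (phi z - \sum_(j < m) c j * (z - al) ^+ j) <=
      K * normc (z - al) ^+ m) ->
  exists M : C, forall z, `|z| < 1 -> z != al -> `|taylor c al phi k.+1 z| <= M.
Proof.
move=> km al1 phi1 r0 near.
pose B z := \sum_(j < m) c j * (z - al) ^+ j.
have za2 z : `|z| < 1 -> `|z - al| <= 2.
  by move=> z1; rewrite (le_trans (ler_normB _ _))// -[leRHS]/(1 + 1) lerD// ltW.
have main : exists M : C, forall z, `|z| < 1 -> z != al -> `|taylor c al phi m z| <= M.
  pose S := 1 + \sum_(j < m) `|c j| * 2 ^+ j.
  exists ((`|K|%:C)%C + S / ((r ^+ m)%:C)%C) => z z1 zal.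
  have S0 : 0 <= S by rewrite addr_ge0// sumr_ge0// => i _; rewrite mulr_ge0// exprn_ge0.
  have rm0 : 0 < ((r ^+ m)%:C)%C by rewrite realC_gt0// exprn_gt0.
  have K0 : 0 <= (`|K|%:C)%C by rewrite (lecR 0).
  have z0 : 0 < normc (z - al).
    rewrite lt_neqAle normc_ge0 andbT eq_sym; apply: contraNneq zal => /eq0_normc/eqP.
    by rewrite subr_eq0.
  have [zr|zr] := ltP (normc (z - al)) r.
    apply: (@le_trans _ _ (`|K|%:C)%C); last by rewrite lerDl divr_ge0// ltW.
    rewrite normcR lecR /taylor normcM normcV normcX ler_pdivrMr ?exprn_gt0//.
    by apply: (le_trans (near z zr)); rewrite ler_wpM2r ?ler_norm// exprn_ge0// ltW.
  apply: (@le_trans _ _ (S / ((r ^+ m)%:C)%C)); last by rewrite lerDr.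
  rewrite /taylor normrM normfV ler_pM ?invr_ge0//.
    rewrite (le_trans (ler_normB _ _))// lerD ?phi1//.
    rewrite (le_trans (ler_norm_sum _ _ _))// ler_sum// => i _.
    rewrite normrM ler_wpM2l// normrX lerXn2r ?nnegrE// za2//.
  have zm : ((r ^+ m)%:C)%C <= `|(z - al) ^+ m|.
    by rewrite normcR lecR normcX lerXn2r ?nnegrE ?normc_ge0// ltW.
  by rewrite lef_pV2 ?posrE// (lt_le_trans rm0 zm).
have down : forall p q, (p + q)%N = m -> exists M : C, forall z, `|z| < 1 -> z != al ->
    `|taylor c al phi q z| <= M.
  elim=> [|p IH] q; first by rewrite add0n => ->.
  rewrite addSnnS => /IH[M hM]; exists (2 * M + `|c q|) => z z1 zal.
  have za : z - al != 0 by rewrite subr_eq0.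
  have -> : taylor c al phi q z = (z - al) * taylor c al phi q.+1 z + c q.
    by rewrite taylorS// subrK.
  rewrite (le_trans (ler_normD _ _))// lerD// normrM ler_pM ?za2// hM//.
by apply: (down (m - k.+1)%N); rewrite subnK.
Qed.

Lemma interpolates_near (al : 'I_N -> C) (c : 'I_N -> nat -> C) (phi : C -> C) i : interpolates al n c phi ->
  exists (r K : R), 0 < r /\ forall z, normc (z - al i) < r ->
    normc (phi z - \sum_(j < n i) c i j * (z - al i) ^+ j) <= K * normc (z - al i) ^+ n i.
Proof.
move=> /(_ i) /eqaddOP /bigO_exP[k /= /real_gt0[K K0 ->]].
move=> /nbhs_ballP[e /real_gt0[r r0 ->] h]; exists r, K; split => // z zr.
have := h z; rewrite /ball /= => H.
have {}H := H (ltac:(by rewrite distrC normcR ltcR)).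
by rewrite -lecR rmorphM /= -normcX -!normcR.
Qed.

Lemma near_interpolates (al : 'I_N -> C) (c : 'I_N -> nat -> C) (phi : C -> C) :
  (forall i, exists (r K : R), 0 < r /\ forall z, normc (z - al i) < r ->
    normc (phi z - \sum_(j < n i) c i j * (z - al i) ^+ j) <= K * normc (z - al i) ^+ n i) ->
  interpolates al n c phi.
Proof.
move=> H i; have [r [K [r0 h]]] := H i.
apply/eqaddOP/bigO_exP; exists ((`|K| + 1)%:C)%C; first by apply: realC_gt0; rewrite ltr_wpDl.
apply/nbhs_ballP; exists (r%:C)%C; first exact: realC_gt0.
move=> z; rewrite /ball /= distrC normcR ltcR => zr.
have := h z zr => hz.
apply: (@le_trans _ _ ((K * normc (z - al i) ^+ n i)%:C)%C); first by rewrite -lecR -normcR in hz.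
rewrite [X in _ <= _ * X]normcR -rmorphM lecR normcX ler_wpM2r ?exprn_ge0 ?normc_ge0//.
by rewrite (le_trans (ler_norm K))// lerDl.
Qed.

End Blocks.

(** * The theorem *)

Section Assembly.
Import tagnat.
Local Open Scope classical_set_scope.
Local Open Scope sesquilinear_scope.

Context {R : realType}.
Local Notation C := R[i].
Context {N : nat} (n : 'I_N -> nat) (al : 'I_N -> C) (c : 'I_N -> nat -> C).
Context (al1 : forall i, `|al i| < 1).

Lemma interpolates_resolves phi : (forall z, `|z| < 1 -> `|phi z| <= 1) ->
  interpolates al n c phi ->
  resolves (nodes_mx n al) (jet_one n) (jet_data n c) phi [seq al i | i <- enum 'I_N].
Proof.
move=> phi1 hphi.
pose h z : 'cV[C]_(\sum_(i < N) n i) :=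
  \mxcol_(i < N) \col_(k < n i) taylor (c i) (al i) phi k.+1 z.
have /choice[M hM] : forall s : 'I_(\sum_(i < N) n i), exists M : C,
    forall z, `|z| < 1 -> z != al (sig1 s) -> `|h z s 0| <= M.
  move=> s; have [r [K [r0 hr]]] := interpolates_near (sig1 s) hphi.
  have [M hM] := taylor_bound (ltn_ord (sig2 s)) (al1 (sig1 s)) phi1 r0 hr.
  by exists M => z z1 zal; rewrite !mxE hM.
exists h, (\sum_s `|M s|) => z z1 zs.
have zal i : z != al i.
  by apply: contraNneq zs => ->; apply: map_f; rewrite mem_enum.
split=> s; last first.
  have := hM s z z1 (zal _); rewrite (bigD1 s)//= => /le_trans; apply.
  have M0 : 0 <= M s by exact: le_trans (normr_ge0 _) (hM s z z1 (zal _)).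
  by rewrite (ger0_norm M0) lerDl sumr_ge0.
have za : z - al (sig1 s) != 0 by rewrite subr_eq0.
rewrite /nodes_mx /h mul_mxdiag_mxcol [X in _ - X = _]mxE.
rewrite (@mul_jordan_col _ _ _ (fun k => taylor (c (sig1 s)) (al (sig1 s)) phi k.+1 z)).
rewrite !mxE opprD addrA -mulrBl taylorS//.
case: (sig2 s) => -[|k] kn /=.
  by rewrite /taylor big_ord0 subr0 expr0 divr1 subr0 mulr1.
by rewrite mulr0 sub0r addrAC subrr add0r.
Qed.

(** In each block, multiplying the entries of h one after the other by powers of
z - al i recovers the Taylor remainders of phi; the last entry gives the error
term. *)
Lemma resolves_interpolates phi :
  resolves (nodes_mx n al) (jet_one n) (jet_data n c) phi [::] ->
  (forall i, (0 < n i)%N) -> interpolates al n c phi.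
Proof.
move=> [h [K hK]] n0; apply: near_interpolates => i.
have rec z (k : 'I_(n i)) : `|z| < 1 ->
    (z - al i) * h z (Rank i k) 0 =
    (if k : nat is k'.+1 then oapp (fun o : 'I_(n i) => h z (Rank i o) 0) 0 (insub k') else phi z)
     - c i k.
  move=> z1; have [hE _] := hK z z1 isT.
  pose f k := oapp (fun o : 'I_(n i) => h z (Rank i o) 0) 0 (insub k).
  have fE (o : 'I_(n i)) : f o = h z (Rank i o) 0 by rewrite /f valK.
  have Hf : submxcol (h z) i = \col_(k < n i) f k.
    by apply/matrixP => u v; rewrite !mxE ord1 fE.
  have := hE (Rank i k).
  have -> : (nodes_mx n al *m h z) (Rank i k) 0 =
      al i * f k + (if k : nat is k'.+1 then f k' else 0).
    rewrite -(mul_jordan_col _ _ _ 0) -Hf.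
    have -> : nodes_mx n al *m h z = \mxcol_j (jordan (n j) (al j) *m submxcol (h z) j).
      by rewrite -{1}[h z]submxcolK /nodes_mx mul_mxdiag_mxcol.
    transitivity (submxcol (\mxcol_j (jordan (n j) (al j) *m submxcol (h z) j)) i k 0).
      by rewrite [RHS]mxE.
    by rewrite mxcolK.
  have -> : jet_one n (Rank i k) 0 = (k == 0%N :> nat)%:R :> C.
    transitivity ((submxcol (jet_one n) i) k 0 : C); first by rewrite [RHS]mxE.
    by rewrite /jet_one mxcolK mxE.
  have -> : jet_data n c (Rank i k) 0 = c i k.
    transitivity (submxcol (jet_data n c) i k 0); first by rewrite [RHS]mxE.
    by rewrite /jet_data mxcolK mxE.
  rewrite fE mulrBl => hh.
  have -> : z * h z (Rank i k) 0 - al i * h z (Rank i k) 0 =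
    phi z * (k == 0%N :> nat)%:R - c i k + (if k : nat is k'.+1 then f k' else 0).
    by rewrite -hh; ring.
  by case: k {hh} => -[|k] kn /=; rewrite ?mulr1 ?mulr0 ?addr0 // sub0r addrC.
have chain z k (kn : (k < n i)%N) : `|z| < 1 ->
    phi z - \sum_(j < k.+1) c i j * (z - al i) ^+ j =
    (z - al i) ^+ k.+1 * h z (Rank i (Ordinal kn)) 0.
  move=> z1; elim: k kn => [|k IH] kn.
    by rewrite big_ord1 expr0 mulr1 expr1 rec.
  have kn' : (k < n i)%N by exact: ltnW.
  rewrite big_ord_recr /= opprD addrA (IH kn') [in RHS]exprSr -mulrA rec//=.
  by rewrite (insubT (fun k => k < n i)%N kn') /= mulrBr [c i _ * _]mulrC.
have a1' : normc (al i) < 1 by rewrite -norm_lt1E.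
have z01 : `|0 : C| < 1 by rewrite normr0.
have nn : ((n i).-1 < n i)%N by rewrite prednK.
have [k KE _] := leC_real (le_trans (normr_ge0 (h 0 (Rank i (Ordinal nn)) 0)) ((hK 0 z01 isT).2 _) : (0%:C)%C <= K).
exists (1 - normc (al i)), k; split; first by rewrite subr_gt0.
move=> z zr.
have z1 : `|z| < 1.
  by rewrite norm_lt1E; have := le_normcD (z - al i) (al i); rewrite subrK; lra.
have := chain z _ nn z1; rewrite prednK// => ->.
rewrite normcM normcX mulrC ler_wpM2r ?exprn_ge0 ?normc_ge0//.
by rewrite -lecR -normcR -KE; exact: (hK z z1 isT).2.
Qed.

Lemma jet_data_unimodular u : `|u| = 1 -> jet_data n c = u *: jet_one n ->
  unimodular_constant_data n c.
Proof.
move=> u1 h; exists u => // i j jn.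
have := congr1 (fun M => submxcol M i (Ordinal jn) 0) h.
rewrite /jet_data mxcolK mxE => ->; rewrite mxE [X in X = _]mxE.
have -> : jet_one n (Rank i (Ordinal jn)) 0 = (j == 0%N)%:R :> C.
  transitivity ((submxcol (jet_one n) i) (Ordinal jn) 0 : C); first by rewrite [RHS]mxE.
  by rewrite /jet_one mxcolK mxE.
by case: j {jn} => [|j]; rewrite ?mulr1 ?mulr0.
Qed.

End Assembly.

Theorem mainTheorem1 (R : realType) (N : nat) (alpha : 'I_N -> R[i])
  (halpha : forall i : 'I_N, `|alpha i| < 1) (alpha_inj : injective alpha)
  (n : 'I_N -> nat) (hn : forall i : 'I_N, (0 < n i)%N)
  (c : 'I_N -> nat -> R[i])
  (a : 'I_N -> 'I_N -> nat -> nat -> R[i])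
  (ha : forall i j : 'I_N, kernel_expansion (alpha i) (alpha j) (a i j)) :
  [/\ pick_mx n a c \is hermsymmx,
      (exists phi : R[i] -> R[i],
         [/\ holomorphic_on_disk phi,
             forall z : R[i], `|z| < 1 -> `|phi z| <= 1
           & interpolates alpha n c phi])
        <-> psdmx (pick_mx n a c)
    & ~ unimodular_constant_data n c ->
      ((exists phi : R[i] -> R[i],
          [/\ holomorphic_on_disk phi,
              forall z : R[i], `|z| < 1 -> `|phi z| < 1
            & interpolates alpha n c phi])
         <-> psdmx (pick_mx n a c))].
Proof.
have sZ := stable_nodes n halpha.
have hA : stein (nodes_mx n alpha) (pick_mx n a c) (jet_one n) (jet_data n c).
  apply: stein_pick => i j; exact: kernel_coef_rec.
have herm : pick_mx n a c \is hermsymmx.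
  by apply/is_hermitianmxP; rewrite expr0 scale1r (stein_herm sZ hA).
have nec phi : holomorphic_on_disk phi -> (forall z : R[i], `|z| < 1 -> `|phi z| <= 1) ->
    interpolates alpha n c phi -> psdmx (pick_mx n a c).
  move=> hphi phi1 iphi; split => //.
  apply: (nonneg_of_resolves sZ hA _ (interpolates_resolves halpha phi1 iphi)).
  by split=> z z1 _; [exact: hphi|exact: phi1].
have suff_ : psdmx (pick_mx n a c) -> exists phi : R[i] -> R[i],
    [/\ holomorphic_on_disk phi, interpolates alpha n c phi &
     (forall z : R[i], `|z| < 1 -> `|phi z| < 1) \/
     (unimodular_constant_data n c /\ forall z : R[i], `|phi z| = 1)].
  move=> [_ pA]; have [phi [hphi rphi phi1]] := resolves_of_nonneg sZ hA pA.
  exists phi; split => //; first exact: (resolves_interpolates halpha).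
  case: phi1 => [|[u [u1 cu ->]]]; [by left|right].
  by split => //; exact: jet_data_unimodular cu.
split => //.
- split=> [[phi [hphi phi1 iphi]]|/suff_[phi [hphi iphi phi1]]]; first exact: nec iphi.
  exists phi; split => // z z1; case: phi1 => [h|[_ ->]//].
  by apply: ltW; exact: h.
- move=> nu; split=> [[phi [hphi phi1 iphi]]|/suff_[phi [hphi iphi phi1]]].
    by apply: nec iphi => // z z1; apply: ltW; exact: phi1.
  by exists phi; split => //; case: phi1 => [//|[/nu]].
Qed.
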